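(* Let $\zeta\geq 0$ be a fixed real constant and let $k_1,\dots,k_l$ be positive integers such that $k_1,\dots,k_l\leq \zeta$. Then the normalized character $(-1)^l\,\Sigma_{k_1,\dots,k_l}$ is a polynomial in the shifted Boolean cumulants $\tilde{B}_2,\tilde{B}_3,\dots$ with non-negative coefficients; that is, there is a polynomial with non-negative real coefficients in finitely many variables $b_2,b_3,\dots$ (depending only on $\zeta$ and $k_1,\dots,k_l$) such that for every Young diagram $\lambda$ the value of $(-1)^l\,\Sigma_{k_1,\dots,k_l}$ for $\lambda$ is obtained by substituting $b_i=\tilde{B}_i$, where $\tilde B_i$ are the shifted Boolean cumulants of $\lambda$.
   Context: Cauchy transform of a Young diagram: the content of the box in row $i$ and column $j$ is $j-i$. For a Young diagram $\lambda$ let $x_1<\cdots<x_s$ be the contents of the boxes that can be added to $\lambda$ (so that the result is a Young diagram) and $y_1<\cdots<y_{s-1}$ the contents of the boxes that can be removed from $\lambda$. Put $$G(z)=\frac{(z-y_1)\cdots(z-y_{s-1})}{(z-x_1)\cdots(z-x_s)},\qquad H(z)=\frac{1}{G(z)}.$$ For a fixed constant $\zeta\ge 0$ the shifted Boolean cumulants $\tilde B_2,\tilde B_3,\dots$ of $\lambda$ are the coefficients of the expansion in decreasing powers of $z$ $$H(z+\zeta)=z+\zeta+\tilde B_2 z^{-1}+\tilde B_3 z^{-2}+\cdots$$ (there is no further constant term because $x_1+\cdots+x_s=y_1+\cdots+y_{s-1}$). Normalized characters: for $\lambda$ with $n$ boxes and integers $k_1,\dots,k_l\geq 1$, $$\Sigma_{k_1,\dots,k_l}=\frac{\operatorname{Tr}\rho^{\lambda}(k_1,\dots,k_l,1^{n-k_1-\cdots-k_l})}{\operatorname{Tr}\rho^{\lambda}(e)}\;(n)_{k_1+\cdots+k_l},$$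 where $\rho^\lambda$ is the irreducible representation of $S_n$ indexed by $\lambda$, the argument denotes any permutation in $S_n$ of that cycle type, and $(n)_k=n(n-1)\cdots(n-k+1)$. By convention $\Sigma_{k_1,\dots,k_l}=0$ whenever $k_1+\cdots+k_l>n$. *)

(* Defs.v *)
From HB Require Import structures.
From mathcomp Require Import all_boot all_order all_fingroup all_algebra.
From mathcomp Require Import all_character.
From mathcomp Require Import reals complex mpoly.

Set Implicit Arguments.
Unset Strict Implicit.
Unset Printing Implicit Defensive.

Import GRing.Theory.
Local Open Scope ring_scope.

(* A Young diagram is the sequence of its nonzero row lengths. *)
Definition is_partition (lam : seq nat) : bool :=
  sorted geq lam && (0%N \notin lam).

(* Boxes are pairs (row, column), both numbered from 0. *)
Definition content (b : nat * nat) : int := b.2%:Z - b.1%:Z.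

Definition addable_boxes (lam : seq nat) : seq (nat * nat) :=
  [seq (i, nth 0%N lam i) | i <- iota 0 (size lam).+1
                          & is_partition (incr_nth lam i)].

(* Shortening the last row may leave an empty row at the end, hence the test
   is only on the monotonicity of the row lengths. *)
Definition removable_boxes (lam : seq nat) : seq (nat * nat) :=
  [seq (i, (nth 0%N lam i).-1) | i <- iota 0 (size lam)
                  & sorted geq (set_nth 0%N lam i (nth 0%N lam i).-1)].

(* [laurent_coef p q m] is the coefficient of z^(-m) in the expansion of the
   rational function p / q in decreasing powers of z: multiplying by z^m moves
   it to the constant term of the polynomial part.  See [laurent_coefP]. *)
Definition laurent_coef (R : fieldType) (p q : {poly R}) (m : nat) : R :=
  (('X^m * p) %/ q)`_0.

(* p / q equals its polynomial part, plus the sum over 1 <= m <= N of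
   [laurent_coef p q m] z^(-m), up to a function that is O(z^(-N-1)); this is
   stated after multiplication by z^N q. *)
Lemma laurent_coefP (R : fieldType) (p q : {poly R}) (N : nat) : q != 0 ->
  (size ('X^N * p - q * ('X^N * (p %/ q)
     + \sum_(1 <= m < N.+1) laurent_coef p q m *: 'X^(N - m)))%R
   < size q)%N.
Proof.
move=> q0; set S := (X in _ - q * X).
suff -> : S = ('X^N * p) %/ q.
  suff -> : 'X^N * p - q * (('X^N * p) %/ q) = ('X^N * p) %% q by rewrite ltn_modp.
  by apply/eqP; rewrite subr_eq addrC [q * _]mulrC -divp_eq.
rewrite {}/S; elim: N => [|N IHN].
  by rewrite big_geq // addr0 expr0 !mul1r.
rewrite big_nat_recr //= subnn expr0.
have -> : \sum_(1 <= m < N.+1) laurent_coef p q m *: 'X^(N.+1 - m)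
        = 'X * \sum_(1 <= m < N.+1) laurent_coef p q m *: 'X^(N - m).
  rewrite mulr_sumr; apply: eq_big_nat => m /andP[_ mN].
  by rewrite subSn // exprS scalerAr.
rewrite addrA exprS -!mulrA -mulrDr IHN.
set r := ('X^N * p) %/ q.
have XE : ('X * ('X^N * p)) %/ q = 'X * r + ('X * (('X^N * p) %% q)) %/ q.
  by rewrite {1}(divp_eq ('X^N * p) q) mulrDr mulrA divpD mulpK.
have /size1_polyC rE : (size (('X * (('X^N * p) %% q)) %/ q)%R <= 1)%N.
  rewrite size_divp // leq_subLR addn1 prednK ?lt0n ?size_poly_eq0 //.
  have [->|m0] := eqVneq (('X^N * p) %% q) 0; first by rewrite mulr0 size_poly0.
  by rewrite mulrC size_mulX // ltn_modp.
rewrite XE; congr (_ + _).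
by rewrite /laurent_coef exprS -mulrA XE coefD coefXM add0r alg_polyC -rE.
Qed.

Section Cumulants.

Variables (R : realType) (lam : seq nat) (zeta : R).

(* G = cauchy_num / cauchy_den, and H = cauchy_den / cauchy_num. *)
Definition cauchy_num : {poly R} :=
  \prod_(b <- removable_boxes lam) ('X - (content b)%:~R%:P).

Definition cauchy_den : {poly R} :=
  \prod_(b <- addable_boxes lam) ('X - (content b)%:~R%:P).

(* Meaningful for i >= 2. *)
Definition shifted_boolean_cumulant (i : nat) : R :=
  laurent_coef (cauchy_den \Po ('X + zeta%:P)) (cauchy_num \Po ('X + zeta%:P))
    i.-1.

End Cumulants.

Section Specht.

Variables (F : fieldType) (lam : seq nat).

Let n := sumn lam.
Let G : {group 'S_n} := [set: 'S_n]%G.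

(* The boxes of lam are numbered by 'I_n along its rows: box number k lies in
   row [reshape_index lam k] and column [reshape_offset lam k]. *)
Definition row_stabilizer : {set 'S_n} :=
  [set s : 'S_n |
     [forall k : 'I_n, reshape_index lam (s k) == reshape_index lam k]].

Definition col_stabilizer : {set 'S_n} :=
  [set s : 'S_n |
     [forall k : 'I_n, reshape_offset lam (s k) == reshape_offset lam k]].

(* The Young symmetrizer, as a vector of the regular module F[S_n]. *)
Definition young_symmetrizer : 'rV[F]_#|G| :=
  \sum_(s in row_stabilizer) \sum_(t in col_stabilizer)
     (-1) ^+ t *: delta_mx 0 (gring_index G (s * t)%g).

(* The irreducible representation indexed by lam: the Specht module, that is
   the submodule of the regular module generated by the Young symmetrizer. *)
Definition specht_repr :=
  submod_repr (cyclic_mx_module (regular_repr F G) young_symmetrizer).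

End Specht.

Definition cycle_type (n : nat) (g : 'S_n) : seq nat :=
  [seq #|A| | A : {set 'I_n} <- enum (porbits g)].

(* g has cycles of lengths ks, and fixes the remaining points.  The cycle type
   includes the fixed points, so this forces sumn ks <= n. *)
Definition has_cycle_type (n : nat) (ks : seq nat) (g : 'S_n) : bool :=
  perm_eq (cycle_type g) (ks ++ nseq (n - sumn ks) 1%N).

(* The normalized character Sigma_ks of lam over F, where g is a permutation
   with [has_cycle_type ks g]; no such g exists when sumn ks > sumn lam, and
   the value is then 0 whatever g. *)
Definition normalized_character (F : fieldType) (lam ks : seq nat)
    (g : 'S_(sumn lam)) : F :=
  if (sumn ks <= sumn lam)%N then
    \tr (specht_repr F lam g) / \tr (specht_repr F lam 1%g)
      * (sumn lam ^_ sumn ks)%:R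
  else 0.

(* Main.v *)
Require Import Defs.
From HB Require Import structures.
From mathcomp Require Import all_boot all_order all_fingroup all_algebra.
From mathcomp Require Import all_character.
From mathcomp Require Import reals complex mpoly.
From mathcomp Require Import boolp zify ring lra.

Set Implicit Arguments.
Unset Strict Implicit.
Unset Printing Implicit Defensive.

Import Order.TTheory GRing.Theory Num.Theory.
Local Open Scope ring_scope.

(** For the Young symmetrizer c of lambda, c x c is a multiple of c for every x
    (von Neumann), so chi(g) / chi(1) is the average of the coefficients of c over
    the conjugacy class of g.  These class functions are orthogonal, hence a basis.
    Frobenius' coefficient of x^(lambda + delta) in a_delta p_g pairs to 0 with the
    class function of nu <> lambda: the sum of the transpositions acts on both
    (through the contents, respectively through the Casimir operator conjugated by
    the Vandermonde product), a nonzero pairing forces lambda <= nu in the dominance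
    order, and the content sum is strictly monotone for that order.  So Frobenius'
    formula holds, and iterating its Murnaghan-Nakayama rule expresses the
    normalized character by nested residues: removing a k-cycle replaces one
    x = lambda_i - i by x - k, with weight proportional to the residue at x of
    F_k(z) = H(z) H(z-1) ... H(z-k+1).

    The step x -> x - k multiplies F_k'(z) by
    1 + k k' / ((z - x - k') (z - x + k)), whose expansion at infinity has
    nonnegative coefficients in x as soon as k <= k'.  Treating the smallest cycle
    first, (-1)^l Sigma is therefore a nonnegative polynomial in the coefficients of
    the F_k(z + zeta), and these are nonnegative polynomials in the shifted Boolean
    cumulants because F_k(z + zeta) only involves the shifts by zeta - a >= 0 and
    the expansions of (z - a)^(-j) for a < k <= zeta. *)

(** * Young diagrams and the Young symmetrizer *)

(** The polynomial has to be the same for all diagrams, whereas the recursion runs over the rows.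
    Positivity is therefore proved uniformly in the number m of nodes, in the injective family of
    nodes [x] and in the centre [c] of the expansion, and the nodes enter only through coefficients
    of the F_k. Taking the nodes to be the exponents of x^(lambda + delta), which are natural
    numbers, and c = zeta + m makes the constant term of H(z + zeta) equal to zeta whatever the
    diagram. General nodes occur because lowering one of them need not preserve their order; when
    two nodes collide, the weight of that step is 0. The powers of the lowered node x have to
    disappear from the final polynomial. The residue of F_k at x is -k times the weight of the step,
    so the weighted sum of a power of x - c over all nodes is again a coefficient of F_k, up to the
    factor -k. These factors are the origin of the sign (-1)^l and of the product of the cycle
    lengths that is divided out at the end. *)

Section Diagram.

Variables (lam : seq nat) (n : nat).

Definition box_row (k : 'I_n) := reshape_index lam k.
Definition box_col (k : 'I_n) := reshape_offset lam k.

Lemma box_inj k k' : box_row k = box_row k' -> box_col k = box_col k' -> k = k'.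
Proof.
move=> er ec; apply: val_inj.
by rewrite /= -(reshape_indexK lam k) -[RHS](reshape_indexK lam) -/(box_row _)
  -/(box_col _) er ec.
Qed.

Lemma box_col_ltn k : (box_col k < n)%N.
Proof. exact: leq_ltn_trans (leq_subr _ _) (ltn_ord k). Qed.

Hypotheses (lamP : is_partition lam) (lam_n : sumn lam = n).

Lemma box_row_size k : (box_row k < size lam)%N.
Proof. by apply: reshape_indexP; rewrite lam_n. Qed.

Lemma box_col_nth k : (box_col k < nth 0%N lam (box_row k))%N.
Proof. by apply: reshape_offsetP; rewrite lam_n. Qed.

Lemma box_exists i j : (j < nth 0%N lam i)%N ->
  exists k, box_row k = i /\ box_col k = j.
Proof.
move=> ltj; have := flatten_indexP ltj; rewrite lam_n => ltn.
exists (Ordinal ltn).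
by rewrite /box_row /box_col /= (flatten_indexKl ltj) (flatten_indexKr ltj).
Qed.

Lemma partition_nth i j : (i <= j)%N -> (nth 0%N lam j <= nth 0%N lam i)%N.
Proof.
move=> le_ij; have [gej|ltj] := leqP (size lam) j; first by rewrite nth_default.
case/andP: lamP => slam _.
have tr : transitive geq by move=> x y z /= h1 h2; apply: leq_trans h2 h1.
apply: (sorted_leq_nth tr _ 0%N slam) => //; first by move=> x /=.
by rewrite inE (leq_ltn_trans le_ij).
Qed.

Lemma partition_nth_gt0 i : (i < size lam)%N -> (0 < nth 0%N lam i)%N.
Proof.
move=> lti; case/andP: lamP => _; apply: contraR; rewrite -eqn0Ngt => /eqP <-.
exact: mem_nth.
Qed.

Lemma box_above k i : (i <= box_row k)%N ->
  exists k', box_row k' = i /\ box_col k' = box_col k.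
Proof.
by move=> /partition_nth le_i; apply/box_exists/leq_trans/le_i/box_col_nth.
Qed.

Lemma card_by_column (A : {set 'I_n}) :
  #|A| = (\sum_(j < n) #|[set k in A | box_col k == j]|)%N.
Proof.
rewrite -sum1_card (partition_big (fun k => Ordinal (box_col_ltn k)) predT) //=.
apply: eq_bigr => j _; rewrite -sum1_card; apply: eq_bigl => k.
by rewrite inE.
Qed.

Definition column_injective (T : Type) (f : 'I_n -> T) :=
  forall k k', box_col k = box_col k' -> f k = f k' -> k = k'.

Section ColumnInjective.

Variables (T : eqType) (f : 'I_n -> T) (S : seq T).
Hypothesis f_inj : column_injective f.

(** Either the column reaches below the first [size S] rows, and then has exactly [size S] boxes
    there, which bounds an injective colouring by [S]; or all its boxes lie in those rows and the
    bound is trivial. *)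
Lemma card_colour_column j :
  (#|[set k in [set k | f k \in S] | box_col k == j]|
     <= #|[set k in [set k | (box_row k < size S)%N] | box_col k == j]|)%N.
Proof.
set A := [set k in _ | _]; set B := [set k in _ | _].
have [/existsP[k0 /andP[/eqP ck0 rk0]]|] :=
  boolP [exists k, (box_col k == j) && (size S <= box_row k)%N].
  apply: (@leq_trans (size S)).
    rewrite cardE -(size_map f); apply: uniq_leq_size.
      rewrite map_inj_in_uniq ?enum_uniq // => k k'.
      rewrite !mem_enum !inE => /andP[_ /eqP ck] /andP[_ /eqP ck'] /f_inj; apply.
      by rewrite ck ck'.
    by move=> _ /mapP[k + ->]; rewrite mem_enum !inE => /andP[].
  rewrite -[leqLHS](size_iota 0) -(size_map (@id nat) (iota _ _)).
  rewrite [leqRHS]cardE -(size_map box_row); apply: uniq_leq_size.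
    by rewrite map_id iota_uniq.
  move=> i; rewrite map_id mem_iota add0n => /andP[_ lti].
  have [k [rk ck]] := box_above (leq_trans (ltnW lti) rk0).
  by apply/mapP; exists k; rewrite // mem_enum !inE rk lti ck ck0 /=.
rewrite negb_exists => /forallP noex; apply: subset_leq_card.
apply/subsetP => k; rewrite !inE => /andP[_ ckj]; rewrite ckj andbT.
by have := noex k; rewrite ckj /= -ltnNge.
Qed.

Lemma card_colour :
  (#|[set k | f k \in S]| <= #|[set k | (box_row k < size S)%N]|)%N.
Proof.
rewrite card_by_column [leqRHS]card_by_column.
by apply: leq_sum => j _; apply: card_colour_column.
Qed.

End ColumnInjective.

(** Equality of the totals forces equality in each inequality of [card_colour_column]. Hence the
    colour of a box is the number of a row that its column reaches, and moving every box to that row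
    permutes each column. *)
Lemma straighten (f : 'I_n -> nat) : column_injective f ->
    (forall r, #|[set k | (f k < r)%N]| = #|[set k | (box_row k < r)%N]|) ->
  exists t : 'S_n, forall k, box_col (t k) = box_col k /\ box_row (t k) = f k.
Proof.
move=> f_inj fE.
have Eset r : [set k | f k \in iota 0 r] = [set k | (f k < r)%N].
  by apply/setP => k; rewrite !inE mem_iota.
have fcol r (j : 'I_n) : #|[set k in [set k | (f k < r)%N] | box_col k == j]|
    = #|[set k in [set k | (box_row k < r)%N] | box_col k == j]|.
  have le_j (i : 'I_n) : true ->
      (#|[set k in [set k | (f k < r)%N] | box_col k == i]|
     <= #|[set k in [set k | (box_row k < r)%N] | box_col k == i]|
       ?= iff (#|[set k in [set k | (f k < r)%N] | box_col k == i]|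
     == #|[set k in [set k | (box_row k < r)%N] | box_col k == i]|))%N.
    move=> _; split=> //.
    by have := card_colour_column (iota 0 r) f_inj i; rewrite Eset size_iota.
  have [_] := leqif_sum le_j.
  rewrite -!card_by_column fE eqxx => /esym/forallP/(_ j) /=.
  exact: eqP.
have ex k : exists k', (box_col k' == box_col k) && (box_row k' == f k).
  have [/existsP[k1 /andP[/eqP ck1 /box_above[k' [rk' ck']]]]|] :=
     boolP [exists k', (box_col k' == box_col k) && (f k <= box_row k')%N].
    by exists k'; rewrite ck' ck1 rk' !eqxx.
  (* Otherwise every box of the column of [k] lies in a row above row [f k], so by equality of the
     counts they all have a colour smaller than [f k], including [k] itself. *)
  rewrite negb_exists => /forallP noex.
  have := fcol (f k) (Ordinal (box_col_ltn k)).
  set A := [set k in _ | _]; set B := [set k in _ | _] => cAB.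
  have AB : A \subset B.
    apply/subsetP => y; rewrite !inE /= => /andP[_ cy]; rewrite cy andbT.
    by have := noex y; rewrite cy /= -ltnNge.
  have kB : k \in B.
    by rewrite !inE eqxx andbT; have := noex k; rewrite eqxx /= -ltnNge.
  have /eqP eAB : A == B by rewrite eqEcard AB cAB /=.
  by move: kB; rewrite -eAB !inE ltnn.
pose h k := xchoose (ex k).
have hP k : box_col (h k) = box_col k /\ box_row (h k) = f k.
  by have /andP[/eqP ? /eqP ?] := xchooseP (ex k).
have h_inj : injective h.
  move=> k k' e; have [c1 r1] := hP k; have [c2 r2] := hP k'.
  by apply: f_inj; rewrite -?c1 -?r1 e ?c2 ?r2.
by exists (perm h_inj) => k; rewrite permE.
Qed.

End Diagram.

Arguments box_row lam {n} k.
Arguments box_col lam {n} k.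

(** * Stabilizers, the Young symmetrizer and its eigenvalues *)

Section ColourStabilizer.

Variables (n : nat) (f : 'I_n -> nat).

Definition colour_stab : {set 'S_n} := [set s : 'S_n | [forall k, f (s k) == f k]].

Lemma colour_stabP (s : 'S_n) : reflect (forall k, f (s k) = f k) (s \in colour_stab).
Proof. by rewrite inE; apply: (iffP forallP) => h k; apply/eqP. Qed.

Lemma colour_stab_group_set : group_set colour_stab.
Proof.
apply/group_setP; split=> [|s t /colour_stabP hs /colour_stabP ht].
  by apply/colour_stabP => k; rewrite perm1.
by apply/colour_stabP => k; rewrite permM ht hs.
Qed.

Canonical colour_stab_group := Group colour_stab_group_set.

Lemma tperm_colour_stab a b : (tperm a b \in colour_stab) = (f a == f b).
Proof.
apply/colour_stabP/eqP => [/(_ a)|eab k]; first by rewrite tpermL.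
by case: tpermP => [->|->|].
Qed.

End ColourStabilizer.

Section YoungSymmetrizer.

Variables (lam : seq nat) (n : nat).

Notation row := (@box_row lam n).
Notation col := (@box_col lam n).
Notation R := (colour_stab row).
Notation C := (colour_stab col).

(** Coefficient of [g] in the Young symmetrizer c. It is kept integral, so that one computation
    serves every field. *)
Definition young_coef (g : 'S_n) : int :=
  \sum_(s in R) \sum_(t in C) (-1) ^+ t * (s * t == g)%g%:R.

Lemma young_coefLR s g t : s \in R -> t \in C ->
  young_coef (s * g * t)%g = (-1) ^+ t * young_coef g.
Proof.
move=> sR tC; rewrite /young_coef mulr_sumr.
rewrite (reindex_inj (mulgI s)) /=.
apply: eq_big => [x|x _]; first by rewrite groupMl.
rewrite mulr_sumr (reindex_inj (mulIg t)) /=.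
apply: eq_big => [y|y _]; first by rewrite groupMr.
rewrite !mulgA (can_eq (mulgK t)) -!mulgA (can_eq (mulKg s)).
by rewrite odd_permM signr_addb mulrA [_ ^+ y * _]mulrC.
Qed.

Lemma young_coefR g t : t \in C -> young_coef (g * t)%g = (-1) ^+ t * young_coef g.
Proof. by move=> tC; rewrite -(young_coefLR g (group1 _) tC) mul1g. Qed.

Lemma young_coefL s g : s \in R -> young_coef (s * g)%g = young_coef g.
Proof.
by move=> sR; rewrite -[LHS]/(young_coef _) -[(s * g)%g]mulg1
  (young_coefLR _ sR (group1 _)) odd_perm1 mul1r.
Qed.

Lemma row_col_stab1 s : s \in R -> s \in C -> s = 1%g.
Proof.
move=> /colour_stabP hr /colour_stabP hc; apply/permP => k.
by rewrite perm1; apply: box_inj.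
Qed.

Lemma young_coef1 : young_coef 1 = 1.
Proof.
rewrite /young_coef (bigD1 1%g) ?group1 //= (bigD1 1%g) ?group1 //=.
rewrite mul1g eqxx odd_perm1 mulr1 !big1 ?addr0 // => [s /andP[sR s1]|t /andP[_ t1]].
  rewrite big1 // => t tC; case: eqP => [e|_]; last by rewrite mulr0.
  have es : s = (t^-1)%g by rewrite -(mulgK t s) e mul1g.
  by case/eqP: s1; apply: row_col_stab1; rewrite // es groupV.
by rewrite mul1g (negPf t1) mulr0.
Qed.

(** Right translation by the transposition preserves [chi] and negates the coefficients of c, so the
    sum equals its opposite. *)
Lemma young_coef_pair0 (chi : 'S_n -> int) a b : a != b -> col a = col b ->
    (forall g, chi (g * tperm a b)%g = chi g) ->
  \sum_g chi g * young_coef g = 0.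
Proof.
move=> ab cab chiE; set S := \sum_g _.
have : S = - S.
  rewrite {1}/S (reindex_inj (mulIg (tperm a b))) /= /S -sumrN.
  apply: eq_bigr => g _.
  by rewrite chiE young_coefR ?tperm_colour_stab ?cab // odd_tperm ab; ring.
by lia.
Qed.

Hypotheses (lamP : is_partition lam) (lam_n : sumn lam = n).

(** Colour each box by the row of its preimage under [g]. The hypothesis makes this colouring
    column-injective, and its colour counts are the row lengths, so [straighten] applies; the column
    permutation found there is the inverse of [t]. *)
Lemma row_col_factor (g : 'S_n) :
    (forall a b, row a = row b -> col (g a) = col (g b) -> a = b) ->
  exists s t, [/\ s \in R, t \in C & g = (s * t)%g].
Proof.
move=> g_inj; pose f k := row (g^-1%g k).
have f_inj : column_injective lam f.
  move=> k k' ck fk; apply: (@perm_inj _ g^-1%g).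
  by apply: g_inj; rewrite ?permKV.
have fE r : #|[set k | (f k < r)%N]| = #|[set k | (row k < r)%N]|.
  rewrite -[RHS](card_imset _ (@perm_inj _ g)); apply: eq_card => k; rewrite inE.
  apply/idP/imsetP => [lt|[k' + ->]]; last by rewrite inE /f permK.
  by exists (g^-1%g k); rewrite ?inE // permKV.
have [t tP] := straighten lamP lam_n f_inj fE.
exists (g * t)%g, t^-1%g; split; last by rewrite mulgK.
  by apply/colour_stabP => k; rewrite permM (tP _).2 /f permK.
by rewrite groupV; apply/colour_stabP => k; rewrite (tP _).1.
Qed.

(* von Neumann's lemma: when g is not in R C, some transposition u in R has
   g^-1 u g in C, which forces a g = - a g. *)
Lemma young_coef_unique (a : 'S_n -> int) :
    (forall s g t, s \in R -> t \in C -> a (s * g * t)%g = (-1) ^+ t * a g) ->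
  forall g, a g = a 1%g * young_coef g.
Proof.
move=> aLR g.
have [/existsP[k /existsP[k' /and4P[nk /eqP rk /eqP ck _]]]|] :=
  boolP [exists k, exists k', [&& k != k', row k == row k',
                                  col (g k) == col (g k') & true]].
  have uR : tperm k k' \in R by rewrite tperm_colour_stab rk.
  have vC : tperm (g k) (g k') \in C by rewrite tperm_colour_stab ck.
  have e : (tperm k k' * g * tperm (g k) (g k') = g)%g.
    by rewrite [(tperm k k' * g)%g]conjgC tpermJ -mulgA tperm2 mulg1.
  have ngk : g k != g k' by rewrite (inj_eq perm_inj).
  have a0 : a g = - a g.
    by rewrite -{1}e aLR // odd_tperm ngk expr1 mulN1r.
  have c0 : young_coef g = - young_coef g.
    by rewrite -{1}e young_coefLR // odd_tperm ngk expr1 mulN1r.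
  by rewrite (_ : a g = 0) 1?(_ : young_coef g = 0) ?mulr0 //; lia.
move=> /existsPn noex.
have [k k' rk ck|s [t [sR tC ->]]] := @row_col_factor g.
  apply/eqP/negPn/negP => nk; have /existsPn/(_ k') := noex k.
  by rewrite nk rk ck !eqxx.
by rewrite -[s]mulg1 aLR // young_coefLR // young_coef1 mulr1 mulrC.
Qed.

(** The scalar h with c c = h c, read off as the coefficient of the identity in c c. *)
Definition young_square : int := \sum_y young_coef y * young_coef y^-1.

Lemma young_coef_square g :
  \sum_y young_coef y * young_coef (y^-1 * g) = young_square * young_coef g.
Proof.
pose S g := \sum_y young_coef y * young_coef (y^-1 * g).
have -> : young_square = S 1%g by apply: eq_bigr => y _; rewrite mulg1.
apply: (@young_coef_unique S)
  => {g} s g t sR tC.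
rewrite /S mulr_sumr (reindex_inj (mulgI s)) /=; apply: eq_bigr => y _.
rewrite young_coefL // mulrCA; congr (_ * _).
by rewrite invMg -!mulgA mulKg mulgA young_coefR.
Qed.

Lemma young_coef_tperm a b : a != b ->
  young_coef (tperm a b) = (row a == row b)%:R - (col a == col b)%:R.
Proof.
move=> ab; have [erow|nrow] := eqVneq (row a) (row b).
  have /negPf -> : col a != col b.
    by apply: contra ab => /eqP ecol; apply/eqP; apply: (box_inj erow).
  rewrite -[tperm a b]mulg1 young_coefL ?young_coef1 ?subr0 //.
  by rewrite tperm_colour_stab erow.
have [ecol|ncol] := eqVneq (col a) (col b).
  rewrite -[tperm a b]mul1g young_coefR ?tperm_colour_stab ?ecol //.
  by rewrite odd_tperm ab young_coef1 mulr1 sub0r expr1.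
rewrite /young_coef big1 ?subr0 // => s /colour_stabP sR; rewrite big1 // => t.
move=> /colour_stabP tC; case: eqP => [/permP e|_]; last by rewrite mulr0.
(* Suppose [tperm a b] is [s * t]. Since [t] preserves columns and the product fixes [k], the box
   [s k] has the column of [k] as well as its row. *)
have sfix k : k != a -> k != b -> s k = k.
  move=> ka kb; apply: box_inj => //.
  by rewrite -[RHS](congr1 col (etrans (e k) (tpermD _ _))) ?permM ?tC // eq_sym.
have sa : s a = a.
  have [//|na] := eqVneq (s a) a; have [eb|nb] := eqVneq (s a) b.
    by move: nrow; rewrite -eb sR eqxx.
  by have /perm_inj/eqP := sfix _ na nb; rewrite (negPf na).
have eta : t a = b by have := e a; rewrite permM tpermL sa.
by move: ncol; rewrite -eta tC eqxx.
Qed.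

(** Twice the sum of the contents: the unordered pairs of boxes in a common row number the sum of
    the column indices, those in a common column the sum of the row indices. It is also the
    eigenvalue of the sum of transpositions, each counted twice. *)
Definition double_content : int :=
  \sum_(a : 'I_n) \sum_(b | b != a) ((row a == row b)%:R - (col a == col b)%:R).

(** The sum of the transpositions is central, so its product with c transforms like c under both
    stabilizers and is a multiple of c. *)
Lemma young_coef_transpositions g :
  \sum_(a : 'I_n) \sum_(b | b != a) young_coef (g * tperm a b)
    = double_content * young_coef g.
Proof.
pose T g := \sum_(a : 'I_n) \sum_(b | b != a) young_coef (g * tperm a b).
have -> : double_content = T 1%g.
  apply: eq_bigr => a _; apply: eq_bigr => b ab.
  by rewrite mul1g young_coef_tperm // eq_sym.
apply: (@young_coef_unique T) => {g} s g t sR tC.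
rewrite /T mulr_sumr (reindex_inj (@perm_inj _ t)) /=; apply: eq_bigr => a _.
rewrite mulr_sumr (reindex_inj (@perm_inj _ t)) /=; apply: eq_big => b.
  by rewrite (inj_eq perm_inj).
by move=> _; rewrite -tpermJ conjgE !mulgA mulgK -!mulgA young_coefL // mulgA young_coefR.
Qed.

(** Up to inversion of [g], this is n! chi(g) / chi(1) for the character chi of the Specht
    module. *)
Definition young_class_fun (g : 'S_n) : int := \sum_x young_coef (g ^ x).

Lemma young_class_funJ g x : young_class_fun (g ^ x) = young_class_fun g.
Proof.
rewrite /young_class_fun [RHS](reindex_inj (mulgI x)) /=.
by apply: eq_bigr => y _; rewrite conjgM.
Qed.

Lemma young_class_fun1 : young_class_fun 1 = n`!%:R.
Proof.
rewrite /young_class_fun (eq_bigr (fun=> 1)) => [|x _]; last by rewrite conj1g young_coef1.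
by rewrite sumr_const card_Sn.
Qed.

End YoungSymmetrizer.

Arguments young_coef lam {n} g.
Arguments young_class_fun lam {n} g.

(** * The character of the Specht module *)

Section SpechtTrace.

Variables (F : numFieldType) (lam : seq nat).
Hypothesis lamP : is_partition lam.

Notation n := (sumn lam).
Notation G := [set: 'S_n]%G.
Notation aG := (regular_repr F G).
Notation coef := (@young_coef lam n).

Lemma young_symmetrizerE i :
  young_symmetrizer F lam 0 i = (coef (enum_val i))%:~R.
Proof.
rewrite /young_symmetrizer summxE /coef rmorph_sum; apply: eq_bigr => s _.
rewrite summxE rmorph_sum; apply: eq_bigr => t _.
rewrite !mxE eqxx /= rmorphM rmorph_sign /=; congr (_ * _).
rewrite rmorph_nat; congr (_%:R); congr nat_of_bool.
by apply/eqP/eqP => [->|e]; [rewrite gring_indexK ?inE | rewrite e gring_valK].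
Qed.

Lemma young_symmetrizer_shift x j :
  (young_symmetrizer F lam *m aG x) 0 j = (coef (enum_val j * x^-1))%:~R.
Proof.
rewrite mxE (bigD1 (gring_index G (enum_val j * x^-1)%g)) //= big1 ?addr0.
  rewrite young_symmetrizerE gring_indexK ?inE // mxE gring_indexK ?inE //.
  by rewrite mulgKV mxE eqxx gring_valK eqxx mulr1.
move=> k nk; rewrite !mxE eqxx /=; case: eqP => [ej|_]; last by rewrite mulr0.
by case/eqP: nk; rewrite ej gring_indexK ?inE // mulgK gring_valK.
Qed.

(** Matrix of left multiplication by c. It commutes with the right regular action, and its row space
    is the Specht module. *)
Definition young_mx : 'M[F]_#|G| :=
  \matrix_i (young_symmetrizer F lam *m aG (enum_val i)).

Notation M := young_mx.

Lemma young_mxE i j : M i j = (coef (enum_val j * (enum_val i)^-1))%:~R.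
Proof. by rewrite -young_symmetrizer_shift mxE. Qed.

Lemma mxtrace_young g :
  \tr (M *m aG g) = (young_class_fun lam g^-1)%:~R.
Proof.
rewrite /young_class_fun rmorph_sum /= (reindex_inj invg_inj) /=.
have -> : \sum_(x : 'S_n) (coef (g^-1 ^ x^-1))%:~R
        = \sum_(x in G) (coef (g^-1 ^ x^-1))%:~R :> F.
  by apply: eq_bigl => x; rewrite inE.
rewrite [RHS]big_enum_val; apply: eq_bigr => i _.
have -> : (M *m aG g) i i = (row i (M *m aG g)) 0 i by rewrite [RHS]mxE.
rewrite row_mul rowK -mulmxA -repr_mxM ?inE //. rewrite young_symmetrizer_shift.
by rewrite invMg conjgE invgK mulgA.
Qed.

Lemma young_matrix_square : M *m M = (young_square lam n)%:~R *: M.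
Proof.
apply/matrixP => i j; rewrite mxE [RHS]mxE !young_mxE -intrM.
rewrite -(young_coef_square lamP erefl) rmorph_sum /=.
pose c k := (enum_val j * k^-1)%g.
have c_inj : injective c by move=> x y /mulgI/invg_inj.
rewrite (reindex_inj c_inj) /=.
transitivity (\sum_(x in G)
    (coef (c x) * coef ((c x)^-1 * (enum_val j * (enum_val i)^-1)))%:~R : F);
  last by apply: eq_bigl => x; rewrite inE.
rewrite [RHS]big_enum_val; apply: eq_bigr => k _.
rewrite !young_mxE -intrM mulrC; congr ((_ * coef _)%:~R).
by rewrite /c invMg invgK -mulgA mulKg.
Qed.

Lemma cyclic_young_mx : (cyclic_mx aG (young_symmetrizer F lam) :=: M)%MS.
Proof.
apply: eqmx_trans (genmxE _) _; rewrite (_ : _ *m _ = M); first exact: eqmx_refl.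
by apply/row_matrixP => i; rewrite row_mul !rowK mul_rV_lin1 /= mxvecK.
Qed.

(** Write M = Q B, where the rows of B form a basis of the Specht module. The relation M M = h M
    becomes B Q = h, and cyclicity of the trace turns the trace of M g into h times the character.
    At the identity this trace is n!, so h is nonzero. *)
Lemma specht_mxtrace : exists2 h : F, h != 0 & forall g,
  \tr (specht_repr F lam g) = h^-1 * (young_class_fun lam g^-1)%:~R.
Proof.
pose U := cyclic_mx aG (young_symmetrizer F lam).
pose Umod := cyclic_mx_module aG (young_symmetrizer F lam).
pose B : 'M_(\rank U, #|G|) := val_submod 1%:M.
have eBM : (B :=: M)%MS.
  exact: eqmx_trans (val_submod1 _) cyclic_young_mx.
have /submxP[Q MQ] : (M <= B)%MS by rewrite eBM.
have /submxP[Z BZ] : (B <= M)%MS by rewrite eBM.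
have Bfree : row_free B by rewrite /row_free val_submod1.
have ZQ : Z *m Q = 1%:M.
  by apply: (row_free_inj Bfree); rewrite mul1mx -mulmxA -MQ -BZ.
pose h : F := (young_square lam n)%:~R.
have BQ : B *m Q = h%:M.
  apply: (row_free_inj Bfree); rewrite mul_scalar_mx -mulmxA -MQ {1}BZ.
  by rewrite -mulmxA young_matrix_square -scalemxAr -BZ.
have trE g : (young_class_fun lam g^-1)%:~R = h * \tr (specht_repr F lam g).
  rewrite -mxtrace_young {1}MQ -mulmxA.
  have -> : B *m aG g = specht_repr F lam g *m B.
    rewrite -val_submodE -[specht_repr F lam g]/(submod_mx Umod g).
    by rewrite -[submod_mx Umod g]mul1mx val_submodJ ?inE.
  by rewrite mulmxA mxtrace_mulC mulmxA BQ mul_scalar_mx mxtraceZ.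
have h0 : h != 0.
  apply/eqP => h0; have /eqP := trE 1%g.
  by rewrite invg1 young_class_fun1 h0 mul0r intr_eq0 pnatr_eq0 eqn0Ngt fact_gt0.
by exists h => // g; rewrite trE mulKf.
Qed.

End SpechtTrace.

Lemma normalized_characterE (F : numFieldType) lam ks (g : 'S_(sumn lam)) :
    is_partition lam ->
  normalized_character F ks g =
    if (sumn ks <= sumn lam)%N then
      (young_class_fun lam g^-1)%:~R / (sumn lam)`!%:R * (sumn lam ^_ sumn ks)%:R
    else 0.
Proof.
move=> lamP; rewrite /normalized_character; case: ifP => // _.
have [h h0 trE] := specht_mxtrace F lamP; rewrite !trE invg1 young_class_fun1.
by rewrite -mulf_div divff ?invr_eq0 // mul1r rmorph_nat.
Qed.

(** * Class functions on the symmetric group *)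

Lemma expg_porbit_mod (T : finType) (g : {perm T}) a i :
  (g ^+ i)%g a = (g ^+ (i %% #|porbit g a|))%g a.
Proof.
rewrite {1}(divn_eq i #|porbit g a|) expgD permM; apply: congr1.
elim: (i %/ _)%N => [|q IHq]; first by rewrite mul0n expg0 perm1.
by rewrite mulSn expgD permM [(g ^+ #|_|)%g a]permX iter_porbit.
Qed.

Lemma expg_porbit_eq (T : finType) (g : {perm T}) a i j :
  ((g ^+ i)%g a == (g ^+ j)%g a) = (i == j %[mod #|porbit g a|])%N.
Proof.
have c_gt0 : (0 < #|porbit g a|)%N by rewrite lt0n card_porbit_neq0.
rewrite expg_porbit_mod [X in _ == X]expg_porbit_mod !permX.
rewrite -!(@nth_traject _ g _ #|porbit g a|) ?ltn_mod //.
by rewrite nth_uniq ?size_traject ?ltn_mod ?uniq_traject_porbit.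
Qed.

Section Conjugacy.

Variable n : nat.
Implicit Types (g h : 'S_n).

(** Sorting the orbits by size matches each orbit of [g] with one of [h] of the same length.
    Choosing a representative [rp] in each, the conjugating permutation sends the e-th iterate of
    one representative to the e-th iterate of the other. *)
Lemma cycle_type_conj g h :
  perm_eq (cycle_type g) (cycle_type h) -> exists x, h = (g ^ x)%g.
Proof.
case: n g h => [|m] g h gh.
  by exists 1%g; apply/permP => -[].
pose le_card := relpre (fun A : {set 'I_m.+1} => #|A|) leq.
pose P := sort le_card (enum (porbits g)); pose Q := sort le_card (enum (porbits h)).
have PQ : [seq #|A| | A : {set 'I_m.+1} <- P] = [seq #|A| | A : {set 'I_m.+1} <- Q].
  rewrite -!sort_map; apply/perm_sortP => //; first exact: leq_total.
    exact: leq_trans.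
  exact: anti_leq.
have sPQ : size P = size Q by rewrite -(size_map (fun A : {set _} => #|A|)) PQ size_map.
have memP A : (A \in P) = (A \in porbits g) by rewrite mem_sort mem_enum.
have memQ A : (A \in Q) = (A \in porbits h) by rewrite mem_sort mem_enum.
have uQ : uniq Q by rewrite sort_uniq enum_uniq.
pose rp (A : {set 'I_m.+1}) := odflt ord0 [pick y in A].
have rpP f A : A \in porbits f -> A = porbit f (rp A).
  case/imsetP => a _ ->; rewrite /rp; case: pickP => [y|/(_ a)].
    by rewrite -eq_porbit_mem => /eqP.
  by rewrite porbit_id.
pose B A := nth set0 Q (index A P).
have BQ A : A \in porbits g -> B A \in porbits h.
  by move=> Ag; rewrite -memQ mem_nth // -sPQ index_mem memP.
have cB A : A \in porbits g -> #|B A| = #|A|.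
  rewrite -memP => AP; have ltA : (index A P < size P)%N by rewrite index_mem.
  rewrite -[in RHS](nth_index set0 AP).
  rewrite -(nth_map set0 0%N (fun A : {set _} => #|A|)) -?sPQ // -PQ.
  by rewrite (nth_map set0).
have B_inj A A' : A \in porbits g -> A' \in porbits g -> B A = B A' -> A = A'.
  rewrite -!memP => AP A'P /eqP; rewrite nth_uniq -?sPQ ?index_mem //.
  by move=> /eqP e; rewrite -(nth_index set0 AP) e nth_index.
have pg k : porbit g k \in porbits g by apply: imset_f.
have ex k : exists e, k == (g ^+ e)%g (rp (porbit g k)).
  have /porbitP[e ke] : k \in porbit g (rp (porbit g k)).
    by rewrite -(rpP g) // porbit_id.
  by exists e; rewrite -ke.

pose y k := (h ^+ xchoose (ex k))%g (rp (B (porbit g k))).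
have card_rp k : #|porbit g k| = #|porbit g (rp (porbit g k))|.
  by rewrite -(rpP g).
(* The exponent is determined only modulo the orbit length, which is the same for matched orbits; so
   [y] does not depend on the chosen exponent. *)
have yE k e : k = (g ^+ e)%g (rp (porbit g k)) -> y k = (h ^+ e)%g (rp (B (porbit g k))).
  move=> ke; apply/eqP; rewrite /y expg_porbit_eq -(rpP h) ?BQ // cB //.
  rewrite card_rp -expg_porbit_eq -ke.
  by rewrite eq_sym (xchooseP (ex k)).
have y_inj : injective y.
  move=> k k' e.
  have Ekk' : porbit g k = porbit g k'.
    apply: B_inj => //; rewrite (rpP h (B _)) ?BQ // [RHS](rpP h (B _)) ?BQ //.
    by have := congr1 (porbit h) e; rewrite !porbit_perm.
  have := eqP (xchooseP (ex k')); have := eqP (xchooseP (ex k)); move: e; rewrite /y.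
  move: (xchoose (ex k)) (xchoose (ex k')) => i j; rewrite -Ekk' => /eqP + ki k'j.
  rewrite expg_porbit_eq -(rpP h) ?BQ // cB // card_rp -expg_porbit_eq.
  by rewrite -ki -k'j => /eqP.
exists (perm y_inj); apply: (mulgI (perm y_inj)); rewrite conjgE mulKVg.
apply/permP => k; rewrite !permM !permE.
have := eqP (xchooseP (ex k)); move: (xchoose (ex k)) => e ke.
have Egk : porbit g (g k) = porbit g k by have := porbit_perm g 1 k; rewrite expg1.
rewrite (yE k e) // (yE (g k) e.+1) Egk; first by rewrite expgSr permM.
by rewrite expgSr permM -ke.
Qed.

Lemma cycle_typeV g : cycle_type g^-1 = cycle_type g.
Proof. by rewrite /cycle_type porbitsV. Qed.

Lemma sumn_cycle_type g : sumn (cycle_type g) = n.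
Proof.
rewrite sumnE big_map big_enum /= -[RHS]card_ord -sum1_card.
rewrite (partition_big (porbit g) (mem (porbits g))) => [|k _]; last exact: imset_f.
apply: eq_bigr => _ /imsetP[a _ ->]; rewrite -sum1_card.
by apply: eq_bigl => k; rewrite eq_porbit_mem.
Qed.

Lemma cycle_type_partition g : is_partition (sort geq (cycle_type g)).
Proof.
rewrite /is_partition sort_sorted => [|a b]; last exact: leq_total.
rewrite mem_sort; apply/mapP => -[A]; rewrite mem_enum => /imsetP[a _ ->] e.
by have := card_porbit_neq0 g a; rewrite -e.
Qed.

End Conjugacy.

(** * Dominance order, orthogonality and completeness *)

Section RowCounts.

Variables (lam : seq nat) (n : nat).
Hypotheses (lamP : is_partition lam) (lam_n : sumn lam = n).

Definition dominance_sum r := #|[set k : 'I_n | (box_row lam k < r)%N]|.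

Lemma card_row i : #|[set k : 'I_n | box_row lam k == i]| = nth 0%N lam i.
Proof.
apply/eqP; rewrite eqn_leq; apply/andP; split.
  rewrite -[leqRHS](size_iota 0) cardE -(size_map (@box_col lam n)).
  apply: uniq_leq_size => [|_ /mapP[k + ->]].
    rewrite map_inj_in_uniq ?enum_uniq // => k k'.
    by rewrite !mem_enum !inE => /eqP rk /eqP rk'; apply: box_inj; rewrite rk.
  by rewrite mem_enum inE mem_iota => /eqP <-; rewrite (box_col_nth lam_n).
rewrite -[leqLHS](size_iota 0) cardE -[leqRHS](size_map (@box_col lam n)).
apply: uniq_leq_size => [|j]; first exact: iota_uniq.
rewrite mem_iota => /andP[_ /(box_exists lam_n)[k [rk ck]]].
by apply/mapP; exists k; rewrite // mem_enum inE rk.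
Qed.

Lemma dominance_sumE r : dominance_sum r = (\sum_(i < r) nth 0%N lam i)%N.
Proof.
elim: r => [|r IHr].
  by rewrite big_ord0 /dominance_sum; apply: eq_card0 => k; rewrite !inE.
rewrite big_ord_recr /= -IHr -card_row /dominance_sum -cardsUI.
rewrite [X in (_ + X)%N](_ : _ = 0%N) ?addn0.
  by apply: eq_card => k; rewrite !inE ltnS leq_eqVlt orbC.
by apply: eq_card0 => k; rewrite !inE; apply/andP => -[lt /eqP e]; rewrite e ltnn in lt.
Qed.

End RowCounts.

Lemma partition_inj lam mu : is_partition lam -> is_partition mu ->
  nth 0%N lam =1 nth 0%N mu -> lam = mu.
Proof.
move=> lamP muP e; have le_size l m : is_partition m ->
    nth 0%N l =1 nth 0%N m -> (size m <= size l)%N.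
  move=> mP lm; rewrite leqNgt; apply/negP => lt.
  by have := partition_nth_gt0 mP lt; rewrite -lm nth_default.
apply: (@eq_from_nth _ 0%N) => [|i _]; last exact: e.
by apply/eqP; rewrite eqn_leq !le_size.
Qed.

Section Orthogonality.

Variable n : nat.
Implicit Types (g : 'S_n) (a : 'S_n -> int).

Definition type_fun a :=
  forall g h, perm_eq (cycle_type g) (cycle_type h) -> a g = a h.

Lemma young_class_fun_type lam : type_fun (young_class_fun lam).
Proof. by move=> g h /cycle_type_conj[x ->]; rewrite young_class_funJ. Qed.

Lemma cycle_typeJ g x : perm_eq (cycle_type (g ^ x)) (cycle_type g).
Proof.
pose X (A : {set 'I_n}) := [set x k | k in A].
have X_inj : injective X by apply/imset_inj/perm_inj.
have porbitJ k : porbit (g ^ x)%g (x k) = X (porbit g k).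
  apply/setP => y; apply/porbitP/imsetP => [[i ->]|[_ /porbitP[i ->] ->]].
    by exists ((g ^+ i)%g k); rewrite ?mem_porbit // -conjXg permJ.
  by exists i; rewrite -conjXg permJ.
have eX : perm_eq (enum (porbits (g ^ x)%g)) (map X (enum (porbits g))).
  apply: uniq_perm; rewrite ?map_inj_uniq ?enum_uniq // => A; rewrite mem_enum.
  apply/imsetP/mapP => [[k _ ->]|[B + ->]].
    exists (porbit g (x^-1%g k)); first by rewrite mem_enum imset_f.
    by rewrite -porbitJ permKV.
  by rewrite mem_enum => /imsetP[k _ ->]; exists (x k); rewrite ?porbitJ.
rewrite /cycle_type (perm_trans (perm_map _ eX)) // -map_comp.
by rewrite (@eq_map _ _ _ (fun A : {set 'I_n} => #|A|)) // => A /=;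
  rewrite card_imset //; apply: perm_inj.
Qed.

Lemma pair_young_class_fun a lam : type_fun a ->
  \sum_g a g * young_class_fun lam g = n`!%:R * \sum_g a g * young_coef lam g.
Proof.
move=> aT; rewrite -card_Sn -sumr_const mulr_suml.
under eq_bigr do rewrite mulr_sumr.
rewrite exchange_big; apply: eq_bigr => x _; rewrite mul1r.
rewrite [RHS](reindex_inj (conjg_inj x)) /=; apply: eq_bigr => g _.
by congr (_ * _); apply: aT; rewrite perm_sym; apply: cycle_typeJ.
Qed.

Lemma young_class_funV lam g : young_class_fun lam g^-1 = young_class_fun lam g.
Proof. by apply: young_class_fun_type; rewrite cycle_typeV. Qed.

(** If [x] sends two boxes of one column of [lam] into one row of [mu], their transposition fixes
    the first factor and negates the second, and the pairing vanishes. Otherwise the rows of [mu]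
    give a column-injective colouring of [lam]. *)
Lemma young_coef_pair_dominance lam mu (x : 'S_n) :
    is_partition lam -> sumn lam = n ->
    \sum_(g : 'S_n) young_coef mu (g^-1 ^ x)%g * young_coef lam g != 0 ->
  forall r, (dominance_sum mu n r <= dominance_sum lam n r)%N.
Proof.
move=> lamP lam_n nz r; pose f k := box_row mu (x k).
have f_inj : column_injective lam f.
  move=> a b cab fab; apply/eqP/negPn/negP => ab; case/eqP: nz.
  apply: (young_coef_pair0 ab cab) => g.
  rewrite invMg tpermV conjMg tpermJ young_coefL //.
  by rewrite tperm_colour_stab -[_ == _]/(f a == f b) fab.
have := card_colour lamP lam_n (iota 0 r) f_inj; rewrite size_iota.
apply: leq_trans; rewrite -(card_imset _ (@perm_inj _ x)); apply: subset_leq_card.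
apply/subsetP => k; rewrite inE => ltk; apply/imsetP; exists (x^-1%g k).
  by rewrite inE mem_iota /f permKV.
by rewrite permKV.
Qed.

Lemma young_class_fun_orth lam mu :
    is_partition lam -> sumn lam = n -> is_partition mu -> sumn mu = n ->
    lam != mu ->
  \sum_(g : 'S_n) young_class_fun mu g * young_class_fun lam g = 0.
Proof.
move=> lamP lam_n muP mu_n ne; rewrite pair_young_class_fun; last exact: young_class_fun_type.
apply/eqP; rewrite mulf_eq0; apply/orP; right; apply/eqP.
under eq_bigr do rewrite -young_class_funV /young_class_fun mulr_suml.
rewrite exchange_big /= big1 // => x _.
apply/eqP; apply: contraNT ne => nz.
have dom1 := young_coef_pair_dominance lamP lam_n nz.
(* Inverting and conjugating the summation variable exchanges the roles of the two diagrams, which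
   gives the reverse comparison. *)
have dom2 : forall r, (dominance_sum lam n r <= dominance_sum mu n r)%N.
  apply: (@young_coef_pair_dominance mu lam x^-1) => //.
  apply: contra nz; rewrite (reindex_inj invg_inj) (reindex_inj (conjg_inj x)) /=.
  by under eq_bigr do rewrite invgK conjgK -conjVg mulrC.
have dom r : dominance_sum lam n r = dominance_sum mu n r.
  by apply/eqP; rewrite eqn_leq dom1 dom2.
apply/eqP/partition_inj => // i; have := dom i.+1.
rewrite !dominance_sumE // !big_ord_recr /= -!(@dominance_sumE _ n) // dom.
by move/addnI.
Qed.

Definition sorted_type g := sort geq (cycle_type g).

Lemma sorted_typeP g h :
  reflect (sorted_type g = sorted_type h) (perm_eq (cycle_type g) (cycle_type h)).
Proof.
apply: perm_sortP => [a b|a b c|a b]; first exact: leq_total.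
  by move=> /= h1 h2; apply: leq_trans h2 h1.
by rewrite /= andbC; apply: anti_leq.
Qed.

Lemma young_class_fun_sqr_gt0 lam :
  0 < \sum_(g : 'S_n) young_class_fun lam g * young_class_fun lam g.
Proof.
rewrite (bigD1 1%g) //= ltr_wpDr //; last first.
  by rewrite young_class_fun1 mulr_gt0 // ltr0n fact_gt0.
by apply: sumr_ge0 => g _; rewrite -expr2 sqr_ge0.
Qed.

(* Cycle types are partitions, so the class functions indexed by the cycle types
   form a square matrix with orthogonal rows, which is therefore invertible. *)
Lemma type_fun_eq0 a : type_fun a ->
    (forall lam, is_partition lam -> sumn lam = n ->
      \sum_g a g * young_class_fun lam g = 0) ->
  forall g, a g = 0.
Proof.
move=> aT a0; pose types := undup [seq sorted_type g | g <- enum 'S_n].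
pose N := size types; pose ty (i : 'I_N) := nth [::] types i.
have tyP g : sorted_type g \in types.
  by rewrite mem_undup; apply: map_f; rewrite mem_enum.
have ty_lt g : (index (sorted_type g) types < N)%N by rewrite index_mem.
pose ind g := Ordinal (ty_lt g).
have ty_ind g : ty (ind g) = sorted_type g by rewrite /ty nth_index.
have ex i : exists g, sorted_type g == ty i.
  have : ty i \in types by rewrite mem_nth.
  by rewrite mem_undup => /mapP[g _ ->]; exists g.
pose rep i := xchoose (ex i).
have repP i : sorted_type (rep i) = ty i by apply/eqP/(xchooseP (ex i)).
have rep_ind b g : type_fun b -> b (rep (ind g)) = b g.
  by move=> bT; apply/bT/sorted_typeP; rewrite repP ty_ind.
have ind_rep i g : (ind g == i) = (sorted_type g == ty i).
  rewrite -ty_ind /ty nth_uniq ?undup_uniq //.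
pose d (i : 'I_N) : int := \sum_(g | ind g == i) 1.
have sum_type b : type_fun b -> \sum_g b g = \sum_i b (rep i) * d i.
  move=> bT; rewrite (partition_big ind predT) //=; apply: eq_bigr => i _.
  by rewrite mulr_sumr; apply: eq_bigr => g /eqP <-; rewrite rep_ind ?mulr1.
have funM b c : type_fun b -> type_fun c -> type_fun (fun g => b g * c g).
  by move=> bT cT g h gh; rewrite (bT g h) // (cT g h).
pose P i := young_class_fun (ty i) : 'S_n -> int.
have PT i : type_fun (P i) by apply: young_class_fun_type.
have tyPart i : is_partition (ty i) /\ sumn (ty i) = n.
  rewrite -repP; split; first exact: cycle_type_partition.
  by rewrite -(sumn_cycle_type (rep i)); apply/perm_sumn; rewrite perm_sort.
pose M := \matrix_(i, j) (P i (rep j))%:~R : 'M[rat]_N.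
pose D := diag_mx (\row_j (d j)%:~R) : 'M[rat]_N.
have DM (b : 'S_n -> int) i j (B : 'M[rat]_(i, N)) k :
    type_fun b -> (forall l, B k l = (b (rep l))%:~R) ->
  (B *m (D *m M^T)) k j = (\sum_g b g * P j g)%:~R.
  move=> bT BE; rewrite (sum_type (fun g => b g * P j g)); last exact: funM.
  rewrite mxE rmorph_sum; apply: eq_bigr => l _.
  rewrite BE mul_diag_mx !mxE -!intrM; congr (_%:~R); ring.
have Mu : M *m (D *m M^T) \in unitmx.
  have -> : M *m (D *m M^T) = diag_mx (\row_i (\sum_g P i g * P i g)%:~R).
    apply/matrixP => i j; rewrite (DM (P i)) //; last by move=> l; rewrite mxE.
    rewrite !mxE; case: eqVneq => [->|ne]; first by rewrite mulr1n.
    have [iP i_n] := tyPart i; have [jP j_n] := tyPart j.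
    rewrite mulr0n young_class_fun_orth //.
    by apply: contra ne; rewrite eq_sym nth_uniq ?undup_uniq.
  rewrite unitmxE det_diag unitfE; apply/prodf_neq0 => i _.
  by rewrite mxE intr_eq0; apply/lt0r_neq0/young_class_fun_sqr_gt0.
move: Mu; rewrite unitmx_mul => /andP[_ DMu].
pose v := \row_j (a (rep j))%:~R : 'rV[rat]_N.
have v0 : v *m (D *m M^T) = 0.
  apply/rowP => j; rewrite (DM a) //; last by move=> l; rewrite mxE.
  by have [jP j_n] := tyPart j; rewrite a0 ?mxE.
move=> g; apply/eqP; have /rowP/(_ (ind g)) : v = 0.
  by rewrite -(mulmxK DMu v) v0 mul0mx.
by rewrite !mxE rep_ind // => /eqP; rewrite intr_eq0.
Qed.

(** Removing from [a] its projection onto the class function of [lam] leaves a class function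
    orthogonal to all of them, hence 0. The value at the identity then fixes the factor. *)
Lemma type_fun_young a lam : type_fun a -> is_partition lam -> sumn lam = n ->
    (forall mu, is_partition mu -> sumn mu = n -> mu != lam ->
      \sum_g a g * young_class_fun mu g = 0) ->
  forall g, n`!%:R * a g = a 1%g * young_class_fun lam g.
Proof.
move=> aT lamP lam_n a0.
pose P := young_class_fun lam : 'S_n -> int.
pose N := \sum_g P g * P g; pose c := \sum_g a g * P g.
have N0 : N != 0 by apply/lt0r_neq0/young_class_fun_sqr_gt0.
have Na g : N * a g = c * P g.
  apply/eqP; rewrite -subr_eq0; apply/eqP.
  apply: (@type_fun_eq0 (fun g => N * a g - c * P g)) => [h k hk|mu muP mu_n].
    by rewrite (aT h k) // /P (young_class_fun_type _ hk).
  under eq_bigr do rewrite mulrBl -!mulrA.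
  rewrite sumrB -!mulr_sumr; have [->|ne] := eqVneq mu lam.
    by rewrite -/N -/c mulrC subrr.
  by rewrite a0 // young_class_fun_orth // !mulr0 subr0.
move=> g; apply: (mulfI N0); rewrite mulrCA Na [RHS]mulrA Na /P young_class_fun1; ring.
Qed.

End Orthogonality.

(** * The cut-and-join operator *)

Section CutJoin.

Variables (n m : nat).
Implicit Types (f : {ffun 'I_n -> 'I_m}) (g : 'S_n).

Definition fixed_by f g := [forall k, f (g k) == f k].

Lemma fixed_byP f g : reflect (forall k, f (g k) = f k) (fixed_by f g).
Proof. by apply: (iffP forallP) => h k; apply/eqP. Qed.

Definition colour_mono f : {mpoly int[m]} := \prod_k 'X_(f k).

(** The product of power sums attached to the cycle type of [g]. Written over colourings that are
    constant on cycles, it shows the effect of multiplying [g] by a transposition. *)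
Definition perm_power_sum g : {mpoly int[m]} :=
  \sum_(f | fixed_by f g) colour_mono f.

Definition recolour f b i : {ffun 'I_n -> 'I_m} :=
  [ffun k => if k == b then i else f k].

Lemma colour_mono_recolour f b i :
  colour_mono (recolour f b i) * 'X_(f b) = colour_mono f * 'X_i.
Proof.
rewrite /colour_mono (bigD1 b) //= [in RHS](bigD1 b) //= ffunE eqxx.
rewrite (eq_bigr (fun k => 'X_(f k))) => [|k /negPf kb]; last by rewrite ffunE kb.
by ring.
Qed.

Variables (g : 'S_n) (i j : 'I_m).
Hypothesis ij : i != j.

(** Both kinds of states admit a = b; there the whole cycle has one colour, and these states supply
    the [colour_weight] terms. [mid_state] is the description common to a left state at [b] and a
    right state at [g b], once the differing colour is replaced by [i]. *)
Let left_state (a b : 'I_n) (f : {ffun 'I_n -> 'I_m}) :=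
  [&& f b == j, (a == b) || (f a == i) & fixed_by f (g * tperm a b)].

Let right_state (a b : 'I_n) (f : {ffun 'I_n -> 'I_m}) :=
  [&& f a == i, (a == b) || (f b == j) & fixed_by f (g * tperm a b)].

Let mid_state (a b : 'I_n) (e : {ffun 'I_n -> 'I_m}) :=
  [&& e a == i, e b == i & [forall k, recolour e a j (g k) == recolour e b j k]].

Lemma left_mid_state a b f : f b = j ->
  left_state a b f = mid_state a b (recolour f b i).
Proof.
move=> fb; rewrite /left_state /mid_state fb eqxx [recolour f b i b]ffunE eqxx.
rewrite eqxx [recolour f b i a]ffunE (_ : (if _ then _ else _) == i = (a == b) || (f a == i)).
  have [ab|] //= := boolP ((a == b) || (f a == i)).
  apply: eq_forallb => k; rewrite permM !ffunE.
  have -> : f (tperm a b (g k)) = if g k == a then j else if g k == b then i else f (g k).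
    case: tpermP => [->|->|/eqP/negPf -> /eqP/negPf ->] //; rewrite eqxx // eq_sym.
    by move: ab fb; case: (a =P b) => [-> _ ->|_ /= /eqP ->].
  by case: (k =P b) => // ->; rewrite fb.
by case: (a == b); rewrite ?eqxx.
Qed.

Lemma right_mid_state a b e : right_state a (g b) e = mid_state a b e.
Proof.
rewrite /right_state /mid_state; have [ea|//] := eqVneq (e a) i; rewrite !andTb.
rewrite (_ : (a == g b) || (e (g b) == j) = (recolour e a j (g b) == j)); last first.
  by rewrite ffunE eq_sym; case: (g b == a); rewrite ?eqxx.
apply/andP/andP => [[/eqP eb /fixed_byP H]|[/eqP eb /forallP H]].
  have tE y : e (tperm a (g b) y) = if y == g b then i else recolour e a j y.
    rewrite ffunE; case: tpermP => [->|->|/eqP/negPf -> /eqP/negPf ->] //.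
      by rewrite eqxx; move: eb; rewrite ffunE eq_sym; case: eqP => // <-.
    by rewrite eqxx.
  have eH k : (if k == b then i else recolour e a j (g k)) = e k.
    by rewrite -[RHS]H permM tE (inj_eq perm_inj).
  split; first by rewrite -eH eqxx.
  apply/forallP => k; rewrite [X in _ == X]ffunE; have := eH k.
  by case: (k =P b) => [-> _|_ <-]; rewrite ?eb.
have gb : recolour e a j (g b) = j by rewrite (eqP (H b)) ffunE eqxx.
split; first exact/eqP.
have tE y : e (tperm a (g b) y) = if y == g b then i else recolour e a j y.
  rewrite ffunE; case: tpermP => [->|->|/eqP/negPf -> /eqP/negPf ->] //.
    by rewrite eqxx; move: gb; rewrite ffunE eq_sym; case: eqP => // <-.
  by rewrite eqxx.
apply/fixed_byP => k; rewrite permM tE (inj_eq perm_inj) (eqP (H k)).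
by rewrite ffunE; case: (k =P b) => [->|].
Qed.

(** For distinct colours i and j, the points a and b lie in different cycles of [g * tperm a b], so
    the transposition has cut a cycle of [g] containing both. *)
Definition cycle_split : {mpoly int[m]} :=
  \sum_(t : 'I_n * 'I_n)
    \sum_(f | fixed_by f (g * tperm t.1 t.2) && ((f t.1, f t.2) == (i, j)))
      colour_mono f.

Definition colour_weight i : {mpoly int[m]} :=
  \sum_(a : 'I_n) \sum_(f | fixed_by f g && (f a == i)) colour_mono f.

(* On the cycle of g through a and b, f is i from a up to the point before b and
   j from b up to the point before a; moving b one step forward turns one j
   into an i. *)
Lemma cycle_split_shift :
  'X_i * (colour_weight j + cycle_split) = 'X_j * (colour_weight i + cycle_split).
Proof.
have splitE (P : 'I_n -> 'I_n -> {ffun 'I_n -> 'I_m} -> bool) l :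
   (forall a f, P a a f = fixed_by f g && (f a == l)) ->
   (forall a b f, a != b ->
      P a b f = fixed_by f (g * tperm a b) && ((f a, f b) == (i, j))) ->
   colour_weight l + cycle_split
     = \sum_(u : 'I_n * 'I_n * {ffun 'I_n -> 'I_m} | P u.1.1 u.1.2 u.2) colour_mono u.2.
  move=> Paa Pab; rewrite -(pair_big_dep predT (fun t f => P t.1 t.2 f)
     (fun _ f => colour_mono f)) /=.
  rewrite [RHS](bigID (fun t => t.1 == t.2)) /=; congr (_ + _).
    rewrite /colour_weight (reindex_onto (fun a => (a, a)) fst) /=; last first.
      by case=> a b /= /eqP <-.
    apply: eq_big => a; first by rewrite !eqxx.
    by move=> _; apply: eq_bigl => f; rewrite Paa.
  rewrite /cycle_split [LHS](bigID (fun t => t.1 == t.2)) /= big1 ?add0r.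
    by apply: eq_bigr => -[a b] /= ab; apply: eq_bigl => f; rewrite Pab.
  case=> a b /= /eqP <-; apply: big1 => f /andP[_ /eqP[fi fj]].
  by case/eqP: ij; rewrite -fi -fj.
rewrite (splitE left_state j); first last.
- move=> a b f /negPf ab; rewrite /left_state ab xpair_eqE /=.
  by do !case: (_ == _) => //=; rewrite ?andbF ?andbT.
- by move=> a f; rewrite /left_state eqxx tperm1 mulg1 /= andbC.
rewrite (splitE right_state i); first last.
- move=> a b f /negPf ab; rewrite /right_state ab xpair_eqE /=.
  by do !case: (_ == _) => //=; rewrite ?andbF ?andbT.
- by move=> a f; rewrite /right_state eqxx tperm1 mulg1 /= andbC.
rewrite !mulr_sumr.
rewrite [RHS](reindex_onto (fun u => (u.1.1, g u.1.2, recolour u.2 u.1.2 i))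
          (fun u => (u.1.1, g^-1%g u.1.2, recolour u.2 (g^-1%g u.1.2) j))) /=.
  apply: eq_big => [[[a b] f]|[[a b] f]] /=.
    rewrite permK; apply/idP/andP => [H|[H /eqP[/ffunP/(_ b)]]].
      have fb : f b = j by case/and3P: H => /eqP.
      rewrite right_mid_state -left_mid_state //; split=> //.
      rewrite !xpair_eqE !eqxx /=; apply/eqP/ffunP => k; rewrite !ffunE.
      by case: eqP => [->|].
    by rewrite ffunE eqxx => fb; rewrite left_mid_state // -right_mid_state.
  by case/and3P=> /eqP fb _ _; rewrite ['X_j * _]mulrC -fb colour_mono_recolour mulrC.
case=> [[a b] f] /=; rewrite /right_state => /and3P[/eqP fa _ /fixed_byP H].
have := H (g^-1%g b); rewrite permM !permKV tpermR fa => fb.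
by congr (_, _, _); apply/ffunP => k; rewrite !ffunE; case: eqP => [->|].
Qed.

End CutJoin.

Lemma derivation_prod (A : comNzRingType) (D : A -> A) (I : finType) (P : pred I)
    (F : I -> A) :
    D 1 = 0 -> (forall x y, D (x * y) = D x * y + x * D y) ->
  D (\prod_(k | P k) F k) =
    \sum_(k | P k) D (F k) * \prod_(k' | P k' && (k' != k)) F k'.
Proof.
move=> D1 DM; rewrite -big_filter -[RHS]big_filter.
under [in RHS]eq_bigr do rewrite -big_filter_cond.
have: uniq [seq k <- index_enum I | P k] by rewrite filter_uniq ?index_enum_uniq.
elim: (filter _ _) => [|x r IHr] /=; first by rewrite !big_nil.
case/andP=> xr ur; rewrite !big_cons DM IHr //= eqxx /=; congr (_ + _).
  congr (_ * _); rewrite [RHS]big_seq_cond [LHS]big_seq.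
  by apply: eq_bigl => k; case: eqP => [->|]; rewrite ?(negPf xr) ?andbT.
rewrite mulr_sumr big_seq [RHS]big_seq; apply: eq_bigr => k kr.
rewrite big_cons (_ : x != k); last by apply: contraNneq xr => ->.
by rewrite mulrCA.
Qed.

(** * Euler operators and the Vandermonde product *)

Section Euler.

Variable m : nat.
Implicit Types (P Q : {mpoly int[m]}) (l : 'X_{1..m}).

Definition euler (i : 'I_m) P : {mpoly int[m]} := 'X_i * P^`M(i).

Lemma euler_is_linear i : linear (euler i).
Proof. by move=> c P Q; rewrite /euler linearP mulrDr scalerAr. Qed.
HB.instance Definition _ i := GRing.isLinear.Build _ _ _ _ (euler i) (euler_is_linear i).

Lemma eulerM i P Q : euler i (P * Q) = euler i P * Q + P * euler i Q.
Proof. by rewrite /euler mderivM; ring. Qed.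

Lemma euler1 i : euler i 1 = 0.
Proof. by rewrite /euler -mpolyC1 mderivC mulr0. Qed.

Lemma eulerXm i l : euler i 'X_[l] = 'X_[l] *+ l i.
Proof.
rewrite /euler mderivX scaler_nat.
have [->|li] := eqVneq (l i) 0%N; first by rewrite !mulr0n mulr0.
by rewrite mulrnAr -mpolyXD addmC submK ?lep1mP.
Qed.

Lemma euler_mcoeff i P l : (euler i P)@_l = (l i)%:R * P@_l.
Proof.
rewrite [in LHS](mpolyE P) [in RHS](mpolyE P) raddf_sum !raddf_sum mulr_sumr.
apply: eq_bigr => k _; rewrite /= linearZ /= eulerXm !mcoeffZ mcoeffMn mcoeffX mulrCA.
by case: eqP => [->|]; rewrite ?mul0rn ?mulr0 // mulr_natl.
Qed.

Lemma eulerX i j : euler i 'X_j = (i == j)%:R * 'X_j.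
Proof. by rewrite eulerXm mnm1E eq_sym mulr_natl. Qed.

Definition euler2 P : {mpoly int[m]} := \sum_i euler i (euler i P).

Lemma euler2_is_linear : linear euler2.
Proof.
move=> c P Q; rewrite /euler2 scaler_sumr -big_split; apply: eq_bigr => i _.
by rewrite /= !linearP.
Qed.
HB.instance Definition _ := GRing.isLinear.Build _ _ _ _ euler2 euler2_is_linear.

Lemma euler2Xm l : euler2 'X_[l] = 'X_[l] *+ \sum_i l i ^ 2.
Proof.
rewrite /euler2 -sumrMnr; apply: eq_bigr => i _.
by rewrite eulerXm raddfMn /= eulerXm -mulrnA.
Qed.

Lemma euler2_mcoeff P l : (euler2 P)@_l = P@_l *+ \sum_i l i ^ 2.
Proof.
rewrite raddf_sum -sumrMnr; apply: eq_bigr => i _.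
by rewrite /= !euler_mcoeff mulrA -natrM mulr_natl.
Qed.

Lemma euler2M P Q :
  euler2 (P * Q) = euler2 P * Q + 2 * (\sum_i euler i P * euler i Q) + P * euler2 Q.
Proof.
rewrite /euler2 !mulr_sumr mulr_suml -!big_split /=; apply: eq_bigr => i _.
by rewrite !eulerM raddfD /= !eulerM; ring.
Qed.

Definition vandermonde : {mpoly int[m]} :=
  \prod_(e : 'I_m * 'I_m | (e.1 < e.2)%N) ('X_(e.2) - 'X_(e.1)).

(** The Vandermonde product without one factor; it replaces a division by a difference of two
    variables. *)
Definition vandermonde_cofactor (e : 'I_m * 'I_m) : {mpoly int[m]} :=
  \prod_(e' : 'I_m * 'I_m | (e'.1 < e'.2)%N && (e' != e)) ('X_(e'.2) - 'X_(e'.1)).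

Lemma vandermonde_cofactorE (e : 'I_m * 'I_m) : (e.1 < e.2)%N ->
  vandermonde = ('X_(e.2) - 'X_(e.1)) * vandermonde_cofactor e.
Proof. by move=> lte; rewrite /vandermonde (bigD1 e). Qed.

Lemma euler_vandermonde (Y : 'I_m -> {mpoly int[m]}) :
  \sum_i euler i vandermonde * Y i
    = \sum_(e : 'I_m * 'I_m | (e.1 < e.2)%N)
        ('X_(e.2) * Y e.2 - 'X_(e.1) * Y e.1) * vandermonde_cofactor e.
Proof.
have sumX (j : 'I_m) : \sum_i (i == j)%:R * 'X_j * Y i = 'X_j * Y j.
  rewrite (bigD1 j) //= eqxx mul1r big1 ?addr0 // => i /negPf ->.
  by rewrite !mul0r.
under eq_bigr => i _.
  rewrite /vandermonde derivation_prod; [|exact: euler1|exact: eulerM].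
  rewrite mulr_suml; under eq_bigr do rewrite -/(vandermonde_cofactor _) raddfB /= !eulerX.
  over.
rewrite exchange_big /=; apply: eq_bigr => e _.
rewrite -(sumX e.2) -(sumX e.1) -sumrB mulr_suml; apply: eq_bigr => i _; ring.
Qed.

Definition delta_mnm (s : 'S_m) : 'X_{1..m} := [multinom (s i : nat) | i < m].

Lemma vandermonde_sum :
  vandermonde = \sum_(s : 'S_m) (-1) ^+ s * 'X_[delta_mnm s].
Proof.
have := det_Vandermonde (\row_i ('X_i : {mpoly int[m]})).
under eq_bigr do under eq_bigr do rewrite !mxE.
rewrite (pair_big_dep predT (fun i j : 'I_m => (i < j)%N)
  (fun i j => 'X_j - 'X_i)) /= -/vandermonde => <-.
rewrite /determinant (reindex_inj invg_inj) /=; apply: eq_bigr => s _.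
rewrite odd_permV; congr (_ * _); rewrite (reindex_inj (@perm_inj _ s)) /=.
rewrite mpolyXE_id; apply: eq_bigr => i _.
by rewrite !mxE permK mnmE.
Qed.

(** The exponents of each monomial are a permutation of 0, ..., m - 1, so all monomials have the
    same eigenvalue. *)
Lemma euler2_vandermonde :
  euler2 vandermonde = vandermonde *+ \sum_(i < m) i ^ 2.
Proof.
rewrite vandermonde_sum raddf_sum -sumrMnl; apply: eq_bigr => s _ /=.
rewrite -!(rmorph_sign (@mpolyC m int)) !mul_mpolyC linearZ /= euler2Xm scalerMnr.
congr (_ *: (_ *+ _)); rewrite [RHS](reindex_inj (@perm_inj _ s)) /=.
by apply: eq_bigr => i _; rewrite mnmE.
Qed.

End Euler.
Section Casimir.

Variables (n m : nat).
Implicit Types (f : {ffun 'I_n -> 'I_m}) (g : 'S_n) (i j : 'I_m).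

Definition colour_count f i := #|[set k | f k == i]|.

Definition colour_mnm f : 'X_{1..m} := [multinom colour_count f i | i < m].

Lemma colour_monoE f : colour_mono f = 'X_[colour_mnm f].
Proof.
rewrite /colour_mono mprodXE; congr 'X_[_]; apply/mnmP => i.
rewrite mnm_sumE mnmE /colour_count -sum1_card [RHS]big_mkcond /=.
by apply: eq_bigr => k _; rewrite mnm1E inE; case: eqP.
Qed.

Lemma euler_colour_mono f i :
  euler i (colour_mono f) = colour_mono f *+ colour_count f i.
Proof. by rewrite colour_monoE eulerXm mnmE. Qed.

Lemma euler_perm_power_sum g i : euler i (perm_power_sum m g) = colour_weight g i.
Proof.
rewrite raddf_sum /colour_weight.
under [RHS]eq_bigr do rewrite big_mkcondr.
rewrite exchange_big; apply: eq_bigr => f _ /=.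
rewrite euler_colour_mono /colour_count -sumr_const [LHS]big_mkcond /=.
by apply: eq_bigr => k _; rewrite inE.
Qed.

Lemma colour_count_sum f : (\sum_i colour_count f i = n)%N.
Proof.
rewrite -[RHS]card_ord -sum1_card (partition_big f predT) //=.
by apply: eq_bigr => i _; rewrite /colour_count -sum1_card; apply: eq_bigl => k; rewrite inE.
Qed.

Lemma sum_colour_weight g : \sum_i colour_weight g i = perm_power_sum m g *+ n.
Proof.
under eq_bigr do rewrite -euler_perm_power_sum raddf_sum.
rewrite exchange_big /= -sumrMnl; apply: eq_bigr => f _.
under eq_bigr do rewrite euler_colour_mono.
by rewrite sumrMnr colour_count_sum.
Qed.

Lemma sum_colour_count_sqr f :
  (\sum_i colour_count f i ^ 2
     = n + #|[set t : 'I_n * 'I_n | (t.2 != t.1) && (f t.1 == f t.2)]|)%N.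
Proof.
transitivity #|[set t : 'I_n * 'I_n | f t.1 == f t.2]|.
  rewrite -[RHS]sum1_card (partition_big (fun t : 'I_n * 'I_n => f t.1) predT) //=.
  apply: eq_bigr => i _; rewrite -mulnn /colour_count -cardsX -sum1_card.
  apply: eq_bigl => t; rewrite !inE andbC.
  by case: (f t.1 =P i) => [->|]; rewrite ?andbF //= eq_sym andbT.
rewrite -[in LHS](cardsID [set t | t.2 == t.1]); congr (_ + _)%N.
  rewrite -[RHS]card_ord -[RHS](@card_imset _ _ (fun a => (a, a))); last by move=> a b [].
  apply: eq_card => -[a b]; rewrite !inE /=.
  apply/andP/imsetP => [[_ /eqP ->]|[c _ [-> ->]]]; last by rewrite !eqxx.
  by exists a.
by apply: eq_card => t; rewrite !inE.
Qed.

(** A colouring that agrees at a and b is fixed by [g * tperm a b] exactly when it is fixed by [g];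
    counting such pairs gives the sum of the squared colour counts minus n, an [euler2] eigenvalue.
    The other colourings form the [cycle_split] terms. *)
Lemma sum_perm_power_sum_tperm g :
  \sum_(t : 'I_n * 'I_n | t.2 != t.1) perm_power_sum m (g * tperm t.1 t.2)
    = euler2 (perm_power_sum m g) - perm_power_sum m g *+ n
      + \sum_(e : 'I_m * 'I_m | e.2 != e.1) cycle_split g e.1 e.2.
Proof.
under eq_bigr => t _.
  rewrite /perm_power_sum (bigID (fun f : {ffun 'I_n -> 'I_m} => f t.1 == f t.2)) /=.
  over.
rewrite big_split /=; congr (_ + _).
  rewrite raddf_sum -sumrMnl -sumrB /=.
  transitivity (\sum_(t : 'I_n * 'I_n | t.2 != t.1)
      \sum_(f : {ffun 'I_n -> 'I_m} | fixed_by f g && (f t.1 == f t.2)) colour_mono f).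
    apply: eq_bigr => t _; apply: eq_bigl => f.
    have [e|] := eqVneq (f t.1) (f t.2); rewrite ?andbF // !andbT.
    by apply: eq_forallb => k; rewrite permM; case: tpermP => [->|->|]; rewrite ?e.
  under [LHS]eq_bigr do rewrite big_mkcondr.
  rewrite exchange_big; apply: eq_bigr => f _ /=.
  rewrite [in RHS]colour_monoE euler2Xm -colour_monoE.
  under [in RHS]eq_bigr do rewrite mnmE.
  rewrite sum_colour_count_sqr mulrnDr addrAC subrr add0r -sumr_const -big_mkcondr /=.
  by apply: eq_bigl => t; rewrite inE.
transitivity (\sum_(t : 'I_n * 'I_n | t.2 != t.1)
  \sum_(e : 'I_m * 'I_m | e.2 != e.1)
   \sum_(f : {ffun 'I_n -> 'I_m}
     | fixed_by f (g * tperm t.1 t.2) && ((f t.1, f t.2) == e)) colour_mono f).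
  apply: eq_bigr => t _.
  rewrite (partition_big (fun f : {ffun 'I_n -> 'I_m} => (f t.1, f t.2))
    (fun e => e.2 != e.1)) /=.
    apply: eq_bigr => -[i j] /= ij; apply: eq_bigl => f.
    rewrite -andbA; congr (_ && _); rewrite andb_idl // => /eqP[-> ->].
    by rewrite eq_sym.
  by move=> f /andP[_]; rewrite eq_sym.
rewrite exchange_big /=; apply: eq_bigr => -[i j] /= ij.
rewrite /cycle_split [RHS](bigID (fun t => t.2 == t.1)) /= [X in _ = X + _]big1 ?add0r //.
case=> a b /= /eqP ->; apply: big1 => f /andP[_ /eqP[fi fj]].
by move: ij; rewrite -fi -fj eqxx.
Qed.

(** By [cycle_split_shift], the cofactor times X_j - X_i clears the denominators. With Y the Euler
    derivatives of the power sum, the pairs (i, j) and (j, i) together give 2 (X_i Y_j - X_j Y_i),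
    that is 2 (X_j Y_j - X_i Y_i) - 2 (X_j - X_i) (Y_i + Y_j): a logarithmic derivative and a
    multiple of Y_i + Y_j, whose sum over all pairs is (m - 1) n times the power sum. *)
Lemma vandermonde_cycle_split g :
  vandermonde m * \sum_(e : 'I_m * 'I_m | e.2 != e.1) cycle_split g e.1 e.2
    = 2 * (\sum_i euler i (vandermonde m) * euler i (perm_power_sum m g))
      - vandermonde m * perm_power_sum m g *+ (2 * (m.-1 * n)).
Proof.
pose Y i : {mpoly int[m]} := colour_weight g i.
have split_eq i j : i != j ->
    ('X_j - 'X_i) * cycle_split g i j = 'X_i * Y j - 'X_j * Y i.
  move=> ij; have := cycle_split_shift g ij; rewrite !mulrDr => e.
  rewrite mulrBl; apply/eqP; rewrite subr_eq addrAC eq_sym subr_eq.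
  by rewrite e addrC.
have sumlt (F : 'I_m * 'I_m -> {mpoly int[m]}) :
    \sum_(e | e.2 != e.1) F e
      = \sum_(e : 'I_m * 'I_m | (e.1 < e.2)%N) (F e + F (e.2, e.1)).
  rewrite (bigID (fun e : 'I_m * 'I_m => (e.1 < e.2)%N)) /= big_split /=; congr (_ + _).
    apply: eq_bigl => -[i j] /=; rewrite -(inj_eq val_inj) /=; lia.
  rewrite [RHS](reindex_onto (fun e : 'I_m * 'I_m => (e.2, e.1)) (fun e => (e.2, e.1))) /=;
    last by case.
  apply: eq_big => [[i j]|[i j] _] //=; rewrite -(inj_eq val_inj) eqxx andbT /=; lia.
have sumY : \sum_(e : 'I_m * 'I_m | (e.1 < e.2)%N) (Y e.1 + Y e.2)
    = perm_power_sum m g *+ (m.-1 * n).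
  rewrite -(sumlt (fun e => Y e.1)).
  rewrite -(pair_big_dep predT (fun i j => j != i) (fun i _ => Y i)) /=.
  under eq_bigr do rewrite sumr_const.
  rewrite mulnC mulrnA -sum_colour_weight -sumrMnl; apply: eq_bigr => i _.
  by congr (_ *+ _); rewrite cardC1 card_ord.
rewrite -mulrnAr (mulnC 2) mulrnA -sumY.
under [in RHS]eq_bigr do rewrite euler_perm_power_sum.
rewrite (euler_vandermonde Y) (sumlt (fun e => cycle_split g e.1 e.2)) /=.
rewrite mulrnAr !mulr_sumr -sumrMnl -sumrB; apply: eq_bigr => -[i j] /= ltij.
have ne : i != j by rewrite -(inj_eq val_inj) neq_ltn ltij.
rewrite (vandermonde_cofactorE (e := (i, j)) ltij) /=.
set B := vandermonde_cofactor _.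
have e1 := split_eq i j ne; have := split_eq j i; rewrite eq_sym ne => /(_ isT) e2.
transitivity (B * (('X_j - 'X_i) * cycle_split g i j)
   - B * (('X_i - 'X_j) * cycle_split g j i)); first by ring.
by rewrite e1 e2; ring.
Qed.

(* The Casimir operator of gl_m in the coordinates of the maximal torus: the
   Vandermonde product conjugates the cut-and-join operator to sum_i (x_i d/dx_i)^2
   up to scalars. *)
Lemma casimir g :
  \sum_(t : 'I_n * 'I_n | t.2 != t.1)
      vandermonde m * perm_power_sum m (g * tperm t.1 t.2)
    = euler2 (vandermonde m * perm_power_sum m g)
      - vandermonde m * perm_power_sum m g
         *+ (\sum_(i < m) i ^ 2 + (n + 2 * (m.-1 * n))).
Proof.
rewrite -mulr_sumr sum_perm_power_sum_tperm euler2M euler2_vandermonde.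
rewrite mulrDr vandermonde_cycle_split !mulrnDr; ring.
Qed.

Definition frobenius_coef (l : 'X_{1..m}) (g : 'S_n) : int :=
  (vandermonde m * perm_power_sum m g)@_l.

Lemma frobenius_coef_tperm l g :
  \sum_(t : 'I_n * 'I_n | t.2 != t.1) frobenius_coef l (g * tperm t.1 t.2)
    = ((\sum_i l i ^ 2)%N%:R
       - (\sum_(i < m) i ^ 2 + (n + 2 * (m.-1 * n)))%N%:R) * frobenius_coef l g.
Proof.
rewrite /frobenius_coef -raddf_sum /= casimir raddfB raddfMn /= euler2_mcoeff.
by rewrite mulrBl !mulr_natl.
Qed.

Lemma frobenius_coefE l g :
  frobenius_coef l g =
    \sum_(s : 'S_m) \sum_(f | fixed_by f g)
      (-1) ^+ s * (delta_mnm s + colour_mnm f == l)%MM%:R.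
Proof.
rewrite /frobenius_coef vandermonde_sum mulr_suml raddf_sum; apply: eq_bigr => s _.
rewrite mulr_sumr raddf_sum; apply: eq_bigr => f _ /=.
rewrite colour_monoE -(rmorph_sign (@mpolyC m int)) -mulrA mul_mpolyC mcoeffZ.
by rewrite -mpolyXD mcoeffX.
Qed.

End Casimir.

(** * Frobenius' formula *)

Section Content.

Variables (lam : seq nat) (n : nat).
Hypotheses (lamP : is_partition lam) (lam_n : sumn lam = n).

Lemma sum_nth_partition M : (size lam <= M)%N -> (\sum_(i < M) nth 0%N lam i = n)%N.
Proof.
move=> leM; rewrite -lam_n sumnE (big_nth 0%N) big_mkord.
rewrite [RHS](big_ord_widen M (nth 0%N lam)) //.
rewrite [LHS](bigID (fun i : 'I_M => (i < size lam)%N)) /=.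
by rewrite [X in (_ + X)%N]big1 ?addn0 // => i;
  rewrite -leqNgt; apply: nth_default.
Qed.

Lemma sum_box_row (F : nat -> int) M : (size lam <= M)%N ->
  \sum_(a : 'I_n) F (box_row lam a) = \sum_(i < M) F i *+ nth 0%N lam i.
Proof.
move=> leM; have lt (a : 'I_n) : (box_row lam a < M)%N.
  by apply: leq_trans leM; apply: box_row_size.
rewrite (partition_big (fun a => Ordinal (lt a)) predT) //=; apply: eq_bigr => i _.
rewrite -(card_row lam_n) -sumr_const; apply: eq_big => [a|a /eqP[<-] //].
by rewrite inE.
Qed.

Lemma card_above (a : 'I_n) :
  #|[set b : 'I_n | (box_col lam b == box_col lam a) && (box_row lam b < box_row lam a)%N]|
    = box_row lam a.
Proof.
set B := [set b | _]; rewrite cardE -(size_map (@box_row lam n)).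
rewrite -[RHS](size_iota 0); apply: perm_size; apply: uniq_perm.
- rewrite map_inj_in_uniq ?enum_uniq // => b b'; rewrite !mem_enum !inE.
  by move=> /andP[/eqP cb _] /andP[/eqP cb' _] rb; apply: (box_inj rb); rewrite cb.
- exact: iota_uniq.
move=> i; rewrite mem_iota; apply/mapP/idP => [[b + ->]|lti].
  by rewrite mem_enum inE => /andP[].
have [b [rb cb]] := box_above lamP lam_n (ltnW lti).
by exists b; rewrite // mem_enum inE rb cb eqxx.
Qed.

Lemma double_contentE M : (size lam <= M)%N ->
  double_content lam n
    = \sum_(i < M) (nth 0%N lam i ^ 2)%N%:R
      - n%:R - 2 * \sum_(i < M) (i * nth 0%N lam i)%N%:R.
Proof.
move=> leM; rewrite /double_content.
under eq_bigr do rewrite sumrB; rewrite sumrB; congr (_ - _).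
  transitivity (\sum_(a : 'I_n) ((nth 0%N lam (box_row lam a))%:R - 1 : int)).
    apply: eq_bigr => a _; rewrite -(card_row lam_n) -natr_sum.
    rewrite (cardsD1 a) inE eqxx natrD /= addrAC subrr add0r -sum1_card; congr (_%:R).
    rewrite big_mkcond [RHS]big_mkcond; apply: eq_bigr => b _.
    by rewrite !inE eq_sym [box_row _ b == _]eq_sym; case: eqP => //=; case: eqP.
  rewrite sumrB sumr_const card_ord; congr (_ - _).
  rewrite (sum_box_row (fun i => (nth 0%N lam i)%:R) leM); apply: eq_bigr => i _.
  by rewrite -mulrnA mulnn.
pose above a b : bool := (box_col lam b == box_col lam a)
   && (@box_row lam n b < @box_row lam n a)%N.
transitivity (\sum_(a : 'I_n) \sum_(b : 'I_n) ((above a b)%:R + (above b a)%:R : int)).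
  apply: eq_bigr => a _; rewrite big_mkcond; apply: eq_bigr => b _ /=.
  rewrite /above [box_col _ b == _]eq_sym; case: eqVneq => [->|ne] /=.
    by rewrite ltnn eqxx.
  case: eqP => [cab|] //=; have : box_row lam a != box_row lam b.
    by apply: contra ne => /eqP rab; rewrite (box_inj rab cab).
  by case: ltngtP.
have aboveE : \sum_(a : 'I_n) \sum_(b : 'I_n) ((above a b)%:R : int)
    = \sum_(i < M) (i * nth 0%N lam i)%N%:R.
  transitivity (\sum_(a : 'I_n) ((box_row lam a)%:R : int)).
    apply: eq_bigr => a _; rewrite -[in RHS]card_above -natr_sum -sum1_card.
    by rewrite [in RHS]big_mkcond; congr (_%:R); apply: eq_bigr => b _; rewrite inE.
  rewrite (sum_box_row (fun i => i%:R) leM); apply: eq_bigr => i _.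
  by rewrite natrM mulr_natr.
under eq_bigr do rewrite big_split.
rewrite big_split /= aboveE exchange_big /= aboveE; ring.
Qed.

End Content.

(** The contents differ by a sum of (b_i - a_i) s_i, where s_i = a_i + b_i - 2 i drops by at least 2
    at each step. Abel summation bounds it below by twice the sum of the partial-sum differences E,
    which are nonnegative; equal contents force them all to vanish. *)
Lemma dominance_content_eq lam mu n :
    is_partition lam -> sumn lam = n -> is_partition mu -> sumn mu = n ->
    (forall r, (dominance_sum lam n r <= dominance_sum mu n r)%N) ->
  double_content lam n = double_content mu n -> lam = mu.
Proof.
move=> lamP lam_n muP mu_n dom; pose M := (size lam + size mu)%N.
rewrite (double_contentE lamP lam_n (leq_addr _ _) : _ = \sum_(i < M) _ - _ - _).
rewrite (double_contentE muP mu_n (leq_addl _ _) : _ = \sum_(i < M) _ - _ - _).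
pose a i : int := (nth 0%N lam i)%:R; pose b i : int := (nth 0%N mu i)%:R.
pose E r : int := (dominance_sum mu n r)%:R - (dominance_sum lam n r)%:R.
have E_ge0 r : 0 <= E r by rewrite subr_ge0 ler_nat.
have ES r : E r.+1 = E r + (b r - a r).
  by rewrite /E !dominance_sumE // !big_ord_recr /= !natrD /a /b; ring.
have E0 : E 0%N = 0 by rewrite /E !dominance_sumE // !big_ord0 subrr.
pose G r := \sum_(i < r) (b i ^+ 2 - a i ^+ 2 - 2 * i%:R * (b i - a i)).
pose s i := a i + b i - 2 * i%:R.
have mono l (lP : is_partition l) i : ((nth 0%N l i.+1)%:R <= (nth 0%N l i)%:R :> int).
  by rewrite ler_nat partition_nth.
(* Abel summation stopped at [r]: the boundary term is kept, and disappears once [r] exceeds both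
   numbers of rows. *)
have GE r : G r.+1 >= E r.+1 * s r + 2 * \sum_(i < r.+1) E i.
  elim: r => [|r IHr].
    rewrite /G !big_ord_recr !big_ord0 /= ES E0 /s; lia.
  have -> : G r.+2 = G r.+1 + (b r.+1 - a r.+1) * s r.+1.
    by rewrite /G big_ord_recr /= /s; congr (_ + _); ring.
  rewrite big_ord_recr /=.
  have sle : s r.+1 + 2 <= s r.
    have := mono lam lamP r; have := mono mu muP r.
    have r1 : r.+1%:R = r%:R + 1 :> int by rewrite -addn1 natrD.
    rewrite /s /a /b r1; lra.
  have := ler_wpM2l (E_ge0 r.+1) sle; rewrite (ES r.+1).
  move: IHr; move: (\sum_(i < r.+1) E i) (G _) (E r.+1) (s r) (s r.+1) (b _) (a _).
  move=> S g e s0 s1 b1 a1 IHr; rewrite mulrDr => le_e.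
  rewrite mulrDl mulrDr; move: IHr le_e; move: (e * s0) (e * s1) ((b1 - a1) * s1).
  by move=> x y z; lra.
move=> eG; have GM : G M = 0.
  have -> : G M = (\sum_(i < M) (nth 0%N mu i ^ 2)%N%:R - n%:R
       - 2 * \sum_(i < M) (i * nth 0%N mu i)%N%:R)
    - (\sum_(i < M) (nth 0%N lam i ^ 2)%N%:R - n%:R
       - 2 * \sum_(i < M) (i * nth 0%N lam i)%N%:R).
    rewrite !mulr_sumr opprB opprD addrACA [X in _ + _ + X]addrC.
    rewrite /G; transitivity (\sum_(i < M) (b i ^+ 2 - a i ^+ 2)
        - \sum_(i < M) 2 * i%:R * b i + \sum_(i < M) 2 * i%:R * a i).
      by rewrite -!sumrB -big_split; apply: eq_bigr => i _ /=; ring.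
    rewrite sumrB.
    have sq l : \sum_(i < M) (nth 0%N l i ^ 2)%N%:R = \sum_(i < M) ((nth 0%N l i)%:R ^+ 2 : int).
      by apply: eq_bigr => i _; rewrite natrX.
    have ml l : \sum_(i < M) 2 * (i * nth 0%N l i)%N%:R
        = \sum_(i < M) (2 * i%:R * (nth 0%N l i)%:R : int).
      by apply: eq_bigr => i _; rewrite natrM mulrA.
    by rewrite !sq !ml; ring.
  by rewrite eG subrr.
have EM r : (M <= r)%N -> E r = 0.
  move=> leM; rewrite /E !dominance_sumE // (sum_nth_partition mu_n) ?(sum_nth_partition lam_n).
  - by rewrite subrr.
  - exact: leq_trans (leq_addr _ _) leM.
  - exact: leq_trans (leq_addl _ _) leM.
have Ez r : E r = 0.
  have [/EM //|ltr] := leqP M r.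
  case eM: M ltr => [|M'] // ltr; have := GE M'; rewrite -eM GM EM // mul0r add0r => le0.
  have S0 : \sum_(i < M) E i == 0.
    by rewrite eq_le sumr_ge0 // andbT; move: le0; rewrite pmulr_rle0.
  move: S0; rewrite psumr_eq0 // => /allP/(_ (Ordinal (etrans (congr1 _ eM) ltr))).
  by rewrite mem_index_enum => /(_ isT)/eqP.
apply: partition_inj => // i; apply/eqP; have := ES i.
by rewrite !Ez add0r => /esym/eqP; rewrite subr_eq0 eqr_nat eq_sym.
Qed.

Section FrobeniusOrthogonality.

Variables (n m : nat).
Implicit Types (g : 'S_n) (l : 'X_{1..m}).

Lemma perm_power_sumJ g x : perm_power_sum m (g ^ x) = perm_power_sum m g.
Proof.
rewrite /perm_power_sum.
pose h (f : {ffun 'I_n -> 'I_m}) : {ffun 'I_n -> 'I_m} := [ffun k => f (x k)].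
pose h' (f : {ffun 'I_n -> 'I_m}) : {ffun 'I_n -> 'I_m} := [ffun k => f (x^-1%g k)].
have hK : cancel h' h by move=> f; apply/ffunP => k; rewrite !ffunE permK.
have hK' : cancel h h' by move=> f; apply/ffunP => k; rewrite !ffunE permKV.
rewrite [RHS](reindex h); last by exists h' => f _.
apply: eq_big => f.
  apply/fixed_byP/fixed_byP => H k; rewrite ?ffunE.
    by rewrite -(H (x k)) permJ.
  by have := H (x^-1%g k); rewrite !ffunE permKV -permJ permKV.
move=> _; rewrite /colour_mono (reindex_inj (@perm_inj _ x)) /=.
by apply: eq_bigr => k _; rewrite ffunE.
Qed.

Lemma frobenius_coef_type l : type_fun (frobenius_coef (n := n) l).
Proof.
by move=> g h /cycle_type_conj[x ->]; rewrite /frobenius_coef perm_power_sumJ.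
Qed.

Lemma sum_fixed_by_young_coef nu f :
    \sum_g (fixed_by f g)%:R * young_coef nu g != 0 ->
  column_injective nu (f : {ffun 'I_n -> 'I_m}).
Proof.
move=> nz a b cab fab; apply/eqP/negPn/negP => ab; case/eqP: nz.
apply: (young_coef_pair0 ab cab) => g; congr (nat_of_bool _)%:R.
by apply: eq_forallb => k; rewrite permM; case: tpermP => [->|->|]; rewrite ?fab.
Qed.

(** The elements of [B] outside [T] lie below [q], and equally many elements of [T] outside [B] are
    at least [q]. *)
Lemma sum_top (B T : {set 'I_m}) q : #|B| = #|T| ->
    (forall i : 'I_m, (i \in T) = (q <= i)%N) ->
  (\sum_(i in B) i <= \sum_(i in T) i)%N.
Proof.
move=> cBT TE.
rewrite [leqLHS](big_setID T) [leqRHS](big_setID B) /= [T :&: B]setIC leq_add2l.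
have cD : #|B :\: T| = #|T :\: B|.
  by apply/eqP; rewrite -(eqn_add2l #|B :&: T|) cardsID [B :&: T]setIC cardsID cBT.
apply: (@leq_trans (#|B :\: T| * q)).
  rewrite -sum_nat_const; apply: leq_sum => i; rewrite inE TE -ltnNge.
  by case/andP=> /ltnW.
rewrite cD -sum_nat_const; apply: leq_sum => i; rewrite inE TE.
by case/andP.
Qed.

End FrobeniusOrthogonality.

Section FrobeniusFormula.

Variable lam : seq nat.
Hypothesis lamP : is_partition lam.

Notation n := (sumn lam).
Notation m := (size lam).

(** The exponent lambda + delta in increasing order: variable [i] carries row m - 1 - i. *)
Definition shifted_rows : 'X_{1..m} :=
  [multinom (nth 0 lam (rev_ord i) + i)%N | i < m].

Lemma sum_shifted_rows : (\sum_i shifted_rows i = n + \sum_(i < m) i)%N.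
Proof.
under eq_bigr do rewrite mnmE.
rewrite big_split /=; congr (_ + _)%N; rewrite -(sum_nth_partition (erefl n) (leqnn m)).
rewrite [LHS](reindex_inj rev_ord_inj); apply: eq_bigr => i _.
by rewrite (congr1 val (rev_ordK i) : (_ - _)%N = _).
Qed.

(** A nonzero pairing yields a monomial of the Vandermonde product and a column-injective colouring
    of [nu] whose exponents add up to lambda + delta. On the last r variables the Vandermonde
    exponents sum to at most those of delta, so these r colours cover at least the first r rows of
    [lam], and at most the first r rows of [nu]. *)
Lemma frobenius_pair_dominance nu :
    is_partition nu -> sumn nu = n ->
    \sum_(g : 'S_n) frobenius_coef shifted_rows g * young_coef nu g != 0 ->
  forall r, (dominance_sum lam n r <= dominance_sum nu n r)%N.
Proof.
move=> nuP nu_n nz.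
have [s [f [e f_inj]]] : exists (s : 'S_m) (f : {ffun 'I_n -> 'I_m}),
    (delta_mnm s + colour_mnm f)%MM = shifted_rows /\ column_injective nu f.
  pose c (f : {ffun 'I_n -> 'I_m}) := \sum_(g : 'S_n) (fixed_by f g)%:R * young_coef nu g.
  have /existsP[s /existsP[f /andP[/eqP e /sum_fixed_by_young_coef finj]]] :
      [exists s : 'S_m, exists f : {ffun 'I_n -> 'I_m},
         ((delta_mnm s + colour_mnm f)%MM == shifted_rows) && (c f != 0)].
    apply: contraNT nz => /existsPn noex.
    under eq_bigr do rewrite frobenius_coefE mulr_suml.
    rewrite exchange_big big1 // => s _ /=.
    under eq_bigr do rewrite big_mkcond mulr_suml.
    rewrite exchange_big big1 // => f _ /=.
    transitivity ((-1) ^+ s * (delta_mnm s + colour_mnm f == shifted_rows)%MM%:R * c f).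
      rewrite /c mulr_sumr; apply: eq_bigr => g _.
      by case: ifP => _; rewrite ?mul1r ?mul0r ?mulr0.
    have /existsPn/(_ f) := noex s; rewrite negb_and negbK.
    by case: (_ =P shifted_rows) => [_ /= /eqP ->|]; rewrite ?mulr0 ?mul0r.
  by exists s, f.
move=> r; wlog ler : r / (r <= m)%N => [hw|].
  have [/hw //|ltr] := leqP r m.
  apply: (@leq_trans (dominance_sum nu n m)); last first.
    apply: subset_leq_card; apply/subsetP => k; rewrite !inE => /leq_trans; apply.
    exact: ltnW.
  apply: leq_trans (hw m (leqnn _)).
  by rewrite !dominance_sumE // !(sum_nth_partition (erefl n)) // ltnW.
pose T := [set i : 'I_m | (m - r <= i)%N].
have sumT (F : nat -> nat) : (\sum_(i in T) F (rev_ord i) = \sum_(j < r) F j)%N.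
  rewrite (reindex_inj rev_ord_inj) [RHS](big_ord_widen m F) //=.
  apply: eq_big => [j|j _]; last by rewrite subnS subKn // ltnW.
  by rewrite inE /=; have := ltn_ord j; lia.
have cT : #|T| = r.
  by rewrite -sum1_card (sumT (fun=> 1%N)) sum_nat_const card_ord muln1.
have fT := card_colour nuP nu_n (enum T) f_inj.
move: fT; rewrite -cardE cT -/(dominance_sum nu n r); apply: leq_trans.
have -> : #|[set k | f k \in enum T]| = (\sum_(i in T) colour_count f i)%N.
  rewrite -sum1_card (partition_big f (mem T)) /=; last by move=> k; rewrite inE mem_enum.
  apply: eq_bigr => i iT; rewrite /colour_count -sum1_card; apply: eq_bigl => k.
  by rewrite !inE mem_enum andb_idl // => /eqP ->.
rewrite dominance_sumE // -(sumT (nth 0%N lam)).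
rewrite -(leq_add2r (\sum_(i in T) i)) -big_split /=.
apply: (@leq_trans (\sum_(i in T) (s i + colour_count f i))).
  apply: eq_leq; apply: eq_bigr => i _.
  by have := congr1 (fun l : 'X_{1..m} => l i) e; rewrite mnmDE !mnmE => ->.
rewrite big_split /= addnC leq_add2l.
rewrite -(big_imset (fun i : 'I_m => i : nat)) /=; last by move=> i j _ _; apply: perm_inj.
apply: (@sum_top _ _ _ (m - r)) => [|i]; last by rewrite inE.
by rewrite card_imset //; apply: perm_inj.
Qed.

(** Identifies the eigenvalue from the Casimir operator at lambda + delta with the one by which the
    transpositions act on the symmetrizer. *)
Lemma casimir_double_content :
  (\sum_i shifted_rows i ^ 2)%N%:R - (\sum_(i < m) i ^ 2 + (n + 2 * (m.-1 * n)))%N%:R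
    = double_content lam n.
Proof.
rewrite (double_contentE lamP (erefl n) (leqnn m) : _ = \sum_(i < m) _ - _ - _).
apply/eqP; rewrite subr_eq -!natr_sum.
have -> : (\sum_i shifted_rows i ^ 2 = \sum_(i < m) nth 0 lam i ^ 2 + \sum_(i < m) i ^ 2
   + 2 * \sum_(i < m) (m.-1 - i) * nth 0 lam i)%N.
  rewrite big_distrr.
  rewrite [X in (X + _ + _)%N](reindex_inj rev_ord_inj) [X in (_ + X)%N](reindex_inj rev_ord_inj).
  rewrite -!big_split; apply: eq_bigr => i _ /=; rewrite mnmE /= sqrnD.
  congr (_ + _)%N; rewrite [(_ * i)%N]mulnC; congr (2 * (_ * _))%N.
  by have := ltn_ord i; lia.
have e : (\sum_(i < m) (m.-1 - i) * nth 0 lam i + \sum_(i < m) i * nth 0 lam i = m.-1 * n)%N.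
  rewrite -[in RHS](sum_nth_partition (erefl n) (leqnn m)) big_distrr -big_split /=.
  apply: eq_bigr => i _; rewrite -mulnDl subnK //.
  by have := ltn_ord i; lia.
rewrite -e !natrD; move: (\sum_(i < m) nth 0%N lam i ^ 2)%N => A.
by apply/eqP; ring.
Qed.

Lemma frobenius_young (g : 'S_n) :
  n`!%:R * frobenius_coef shifted_rows g
    = frobenius_coef shifted_rows (1%g : 'S_n) * young_class_fun lam g.
Proof.
apply: type_fun_young => // [|nu nuP nu_n ne]; first exact: frobenius_coef_type.
rewrite pair_young_class_fun; last exact: frobenius_coef_type.
apply/eqP; rewrite mulf_eq0; apply/orP; right; apply: contraNT ne => nz.
apply/eqP/esym/(dominance_content_eq lamP (erefl n) nuP nu_n).
  exact: frobenius_pair_dominance.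
apply: (mulIf nz); rewrite -casimir_double_content mulr_sumr mulr_sumr.
(* The sum of the transpositions is self-adjoint for this pairing, so a nonzero pairing equates its
   eigenvalues on the two factors. *)
transitivity (\sum_(t : 'I_n * 'I_n | t.2 != t.1)
    \sum_h frobenius_coef shifted_rows (h * tperm t.1 t.2)%g * young_coef nu h).
  rewrite exchange_big /=; apply: eq_bigr => h _.
  by rewrite -mulr_suml frobenius_coef_tperm mulrA.
under eq_bigr => t _.
  rewrite (reindex_inj (mulIg (tperm t.1 t.2))) /=.
  under eq_bigr do rewrite -mulgA tperm2 mulg1.
  over.
rewrite exchange_big; apply: eq_bigr => h _ /=.
rewrite -mulr_sumr mulrCA -(young_coef_transpositions nuP nu_n).
by rewrite (pair_big_dep predT (fun a b => b != a)
  (fun a b => young_coef nu (h * tperm a b)%g)).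
Qed.

End FrobeniusFormula.

(** * The Murnaghan-Nakayama recursion *)

Section PowerSums.

Variable m : nat.
Implicit Types (l : 'X_{1..m}) (P : {mpoly int[m]}).

Definition power_sum_prod (ks : seq nat) : {mpoly int[m]} :=
  \prod_(k <- ks) \sum_(i < m) 'X_i ^+ k.

Lemma perm_power_sumE n (g : 'S_n) :
  perm_power_sum m g = power_sum_prod (cycle_type g).
Proof.
rewrite /power_sum_prod big_map big_enum /=.
have orbP k : porbit g k \in porbits g by apply: imset_f.
pose T := {A in porbits g}; pose orb k : T := Sub (porbit g k) (orbP k).
have ex (A : T) : exists k, orb k == A.
  case: A => A Ag; case/imsetP: (Ag) => k _ Ak.
  by exists k; apply/eqP/val_inj; rewrite /= Ak.
pose rep A := xchoose (ex A).
have repK A : orb (rep A) = A by apply/eqP/(xchooseP (ex A)).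
rewrite (big_sub (porbits g)) /= bigA_distr_bigA /=.
rewrite /perm_power_sum (reindex_onto (fun F : {ffun T -> 'I_m} => [ffun k => F (orb k)])
   (fun f => [ffun A => f (rep A)])) /=; last first.
  move=> f /fixed_byP fg; apply/ffunP => k; rewrite !ffunE.
  have : porbit g (rep (orb k)) = porbit g k by have := congr1 val (repK (orb k)).
  move/eqP; rewrite eq_porbit_mem => /porbitP[i ->]; elim: i => [|i IHi].
    by rewrite expg0 perm1.
  by rewrite expgSr permM fg.
apply: eq_big => F.
  apply/andP; split; last by apply/eqP/ffunP => A; rewrite !ffunE repK.
  apply/fixed_byP => k; rewrite !ffunE; congr (F _); apply: val_inj => /=.
  by have := porbit_perm g 1 k; rewrite expg1.
move=> _; rewrite /colour_mono (partition_big orb predT) //=.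
apply: eq_bigr => A _; rewrite (eq_bigr (fun=> 'X_(F A))) => [|k /eqP <-].
  rewrite prodr_const; congr (_ ^+ _); apply: eq_card => k.
  rewrite -[in RHS](repK A) /= -[LHS]/(orb k == A) -val_eqE /= -[in LHS](repK A) /=.
  by rewrite eq_porbit_mem.
by rewrite ffunE.
Qed.

Lemma mcoeffMX_le P k l :
  (P * 'X_[k])@_l = if (k <= l)%MM then P@_(l - k) else 0.
Proof.
case: ifP => [kl|nkl]; first by rewrite -{1}(submK kl) addmC mcoeffMX.
apply/eqP; rewrite mcoeff_eq0 (perm_mem (msuppMX _ _)).
apply/negP => /mapP[k' _ e]; move: nkl; rewrite e => /negP; apply.
by apply/mnm_lepP => i; rewrite mnmDE leq_addr.
Qed.

Lemma mcoeffM_power_sum P k l :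
  (P * \sum_(i < m) 'X_i ^+ k)@_l
    = \sum_(i < m) if (k <= l i)%N then P@_(l - U_(i) *+ k) else 0.
Proof.
rewrite mulr_sumr raddf_sum; apply: eq_bigr => i _ /=.
rewrite mpolyXn mcoeffMX_le; congr (if _ then _ else _).
apply/mnm_lepP/idP => [/(_ i)|le j]; rewrite mulmnE mnm1E.
  by rewrite eqxx mul1n.
by case: eqP => [<-|]; rewrite ?mul1n.
Qed.

Lemma msym_vandermonde i j : i != j ->
  msym (tperm i j) (vandermonde m) = - vandermonde m.
Proof.
move=> ij; rewrite vandermonde_sum raddf_sum -sumrN /=.
rewrite (reindex_inj (mulgI (tperm i j))) /=; apply: eq_bigr => s _.
rewrite -(rmorph_sign (@mpolyC m int)) -(rmorph_sign (@mpolyC m int)).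
rewrite !mul_mpolyC msymZ msymX odd_permM odd_tperm ij signr_addb expr1 mulN1r scaleNr.
congr (- (_ *: 'X_[_])); apply/mnmP => k; rewrite !mnmE tpermV permM.
by rewrite tpermK.
Qed.

Lemma msym_power_sum_prod s ks : msym s (power_sum_prod ks) = power_sum_prod ks.
Proof.
rewrite rmorph_prod; apply: eq_bigr => k _.
rewrite rmorph_sum [RHS](reindex_inj (@perm_inj _ s)) /=; apply: eq_bigr => i _.
rewrite rmorphXn /= msymX; congr ('X_[_] ^+ _); apply/mnmP => j.
by rewrite mnmE !mnm1E (can2_eq (permK s) (permKV s)).
Qed.

Definition staircase_coef ks l : int := (vandermonde m * power_sum_prod ks)@_l.

Lemma staircase_coef_eq0 ks l i j : i != j -> l i = l j -> staircase_coef ks l = 0.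
Proof.
move=> ij lij; have : staircase_coef ks l = - staircase_coef ks l; last by lia.
have le : [multinom l (tperm i j k) | k < m] = l.
  by apply/mnmP => k; rewrite mnmE; case: tpermP => [->|->|].
rewrite /staircase_coef -[in LHS]le.
by rewrite -mcoeff_sym msymM msym_vandermonde // msym_power_sum_prod mulNr mcoeffN.
Qed.

End PowerSums.

(** * The degree formula *)

Section StaircaseBase.

Variable m : nat.
Implicit Types (l : 'X_{1..m}).

Lemma mcoeff_power_sum1 r l : (\sum_i l i)%N = r ->
  (power_sum_prod m (nseq r 1))@_l * (\prod_i (l i)`!)%N%:R = r`!%:R.
Proof.
elim: r l => [|r IHr] l.
  move=> /eqP; rewrite sum_nat_eq0 => /forallP l0.
  have -> : l = 0%MM by apply/mnmP => i; rewrite mnm0E; apply/eqP/(implyP (l0 i)).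
  rewrite /power_sum_prod big_nil mcoeff1 eqxx mul1r big1 // => i _.
  by rewrite mnm0E.
move=> lr; rewrite /power_sum_prod big_cons -/(power_sum_prod m (nseq r 1)) mulrC.
rewrite [_ * power_sum_prod _ _]mulrC mcoeffM_power_sum mulr_sumr factS natrM -lr.
rewrite natr_sum mulr_suml; apply: eq_bigr => i _.
case: posnP => [->|li]; first by rewrite mulr0 mul0r.
rewrite mulrC -(IHr (l - U_(i) *+ 1)%MM); last first.
  apply/eqP; rewrite -eqSS -lr -addn1 (bigD1 i) //= [X in _ == X](bigD1 i) //=.
  rewrite mnmBE mulmnE mnm1E eqxx addnAC subnK //; apply/eqP; congr (_ + _)%N.
  by apply: eq_bigr => j /negPf ji; rewrite mnmBE mulmnE mnm1E eq_sym ji subn0.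
rewrite mulrCA; congr (_ * _); rewrite -natrM; congr (_%:R).
rewrite (bigD1 i) //= [in RHS](bigD1 i) //= mulnA; congr (_ * _)%N.
  by rewrite mnmBE mulmnE mnm1E eqxx mul1n subn1; case: (l i) li => // x _; rewrite factS.
by apply: eq_bigr => j /negPf ji; rewrite mnmBE mulmnE mnm1E eq_sym ji subn0.
Qed.

Lemma natr_ffact (A : pzRingType) x j :
  (x ^_ j)%:R = \prod_(a <- [seq a%:R | a <- iota 0 j]) (x%:R - a) :> A.
Proof.
elim: j => [|j IHj]; first by rewrite big_nil ffactn0.
rewrite -addn1 iotaD map_cat big_cat /= big_seq1 -IHj addn1 ffactnSr natrM add0n.
have [lexj|ltxj] := leqP j x; first by rewrite natrB.
by rewrite ffact_small // !mul0r.
Qed.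

Definition vander_val (A : pzRingType) (x : 'I_m -> A) : A :=
  \prod_(e : 'I_m * 'I_m | (e.1 < e.2)%N) (x e.2 - x e.1).

(** Falling factorials are monic of degree j in the variable, so this matrix is a Vandermonde matrix
    times a unitriangular one. *)
Lemma det_ffact (x : 'I_m -> nat) :
  \det (\matrix_(i < m, j < m) (x i ^_ j)%:R) = vander_val (fun i => (x i)%:R : int).
Proof.
pose Q j : {poly int} := \prod_(a <- [seq a%:R | a <- iota 0 j]) ('X - a%:P).
have sQ j : size (Q j) = j.+1 by rewrite size_prod_XsubC size_map size_iota.
have QE y j : (y ^_ j)%:R = (Q j).[y%:R].
  rewrite natr_ffact horner_prod; apply: eq_bigr => a _.
  by rewrite hornerXsubC.
pose C := \matrix_(k < m, j < m) (Q j)`_k.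
have -> : \matrix_(i < m, j < m) (x i ^_ j)%:R
    = (Vandermonde m (\row_i (x i)%:R))^T *m C.
  apply/matrixP => i j; rewrite !mxE QE (@horner_coef_wide _ m) ?sQ //.
  by apply: eq_bigr => k _; rewrite !mxE mulrC.
rewrite det_mulmx det_tr det_Vandermonde -(det_tr C) det_trig; last first.
  by apply/is_trig_mxP => j k ltjk; rewrite !mxE nth_default // sQ.
rewrite [X in _ * X]big1 => [|j _]; last first.
  have : Q j \is monic by apply: (monic_prod_XsubC _ predT id).
  by rewrite !mxE monicE lead_coefE sQ => /eqP.
rewrite mulr1 /vander_val.
rewrite -(pair_big_dep predT (fun i j : 'I_m => (i < j)%N)
  (fun i j => (x j)%:R - (x i)%:R)) /=.
by apply: eq_bigr => i _; apply: eq_bigr => j _; rewrite !mxE.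
Qed.

Lemma staircase_coef_nseq r l : (\sum_i l i = \sum_(i < m) i + r)%N ->
  staircase_coef (nseq r 1) l * (\prod_i (l i)`!)%N%:R
    = r`!%:R * vander_val (fun i => (l i)%:R : int).
Proof.
move=> lr; rewrite /staircase_coef vandermonde_sum mulr_suml raddf_sum mulr_suml.
rewrite -det_ffact /determinant mulr_sumr; apply: eq_bigr => s _ /=.
rewrite -mulrA [_ * power_sum_prod _ _]mulrC mulrA.
rewrite -(rmorph_sign (@mpolyC m int)) -mulrA mul_mpolyC mcoeffZ -mulrA mulrCA.
rewrite mcoeffMX_le [LHS]mulrCA [RHS]mulrCA; congr (_ * _).
under [in RHS]eq_bigr do rewrite mxE; rewrite -natr_prod.
(* If some exponent is too small the coefficient is 0, and so is the corresponding falling factorial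
   in the determinant. *)
case: mnm_lepP => [le|nle]; last first.
  have /existsP[i lti] : [exists i, (l i < delta_mnm s i)%N].
    apply: contraT => /existsPn h; case: nle => i.
    by rewrite leqNgt h.
  rewrite mul0r (bigD1 i) //= ffact_small ?mul0n ?mulr0 //.
  by move: lti; rewrite mnmE.
rewrite -(@mcoeff_power_sum1 r (l - delta_mnm s)%MM); last first.
  apply/eqP; rewrite -(eqn_add2r (\sum_(i < m) i)) [X in _ == X]addnC -lr.
  rewrite [X in (_ + X)%N](reindex_inj (@perm_inj _ s)) -big_split /=; apply/eqP.
  by apply: eq_bigr => i _; rewrite mnmBE -[s i : nat](mnmE (fun i => s i : nat)) subnK.
rewrite -mulrA -natrM -big_split /=; congr (_ * _%:R); apply: eq_bigr => i _.
have := le i; rewrite mnmBE mnmE => lei.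
by rewrite mulnC ffact_fact.
Qed.

End StaircaseBase.

Section Recursion.

Variables (F : numFieldType) (m : nat).
Implicit Types (x : 'I_m -> F) (l : 'X_{1..m}).

Definition shift_at x i (k : nat) : 'I_m -> F :=
  fun j => if j == i then x j - k%:R else x j.

Definition hook_weight k x i : F :=
  \prod_(a < k) (x i - a%:R) * \prod_(j | j != i) ((x i - k%:R - x j) / (x i - x j)).

(* The normalized character, when x lists the lambda_j - j up to a common shift.
   Then hook_weight k x i is n(n-1)...(n-k+1) times the quotient of the numbers of
   standard tableaux (signed, by antisymmetry) after and before x i is lowered by k. *)
Fixpoint frobenius_rec (ks : seq nat) x : F :=
  if ks is k :: ks' then
    \sum_i hook_weight k x i * frobenius_rec ks' (shift_at x i k)
  else 1.

Lemma eq_frobenius_rec ks x y : x =1 y -> frobenius_rec ks x = frobenius_rec ks y.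
Proof. by move=> /funext ->. Qed.

Lemma vander_val_at x (i : 'I_m) :
  vander_val x = \prod_(j : 'I_m | j != i) ((if (j < i)%N then 1 else -1) * (x i - x j))
    * \prod_(e : 'I_m * 'I_m | [&& e.1 < e.2, e.1 != i & e.2 != i]%N)
        (x e.2 - x e.1).
Proof.
rewrite /vander_val (bigID (fun e : 'I_m * 'I_m => (e.1 == i) || (e.2 == i))) /=; congr (_ * _).
  rewrite (reindex_onto (fun j : 'I_m => if (j < i)%N then (j, i) else (i, j))
    (fun e : 'I_m * 'I_m => if e.1 == i then e.2 else e.1)) /=.
    apply: eq_big => j.
      have [->|ne] := eqVneq j i; first by rewrite ltnn /= ltnn.
      have [lt|gt|/val_inj e] := ltngtP j i; last by rewrite e eqxx in ne.
        by rewrite /= lt (negPf ne) !eqxx.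
      by rewrite /= gt !eqxx.
    by case: ifP => _ _ /=; rewrite ?mul1r // mulN1r opprB.
  case=> a b /= /andP[ltab]; have [ai _|_ /= /eqP bi] := eqVneq a i.
    by rewrite -ai ltnNge ltnW.
  by rewrite -bi ltab.
by apply: eq_bigl => e; rewrite negb_or.
Qed.

Lemma vander_val_shift x i k :
  \prod_(j | j != i) (x i - x j) * vander_val (shift_at x i k)
    = vander_val x * \prod_(j | j != i) (x i - k%:R - x j).
Proof.
rewrite !(vander_val_at _ i) !big_split /=.
have -> : \prod_(j | j != i) (shift_at x i k i - shift_at x i k j)
        = \prod_(j | j != i) (x i - k%:R - x j).
  by apply: eq_bigr => j /negPf ji; rewrite /shift_at eqxx ji.
have -> : \prod_(e : 'I_m * 'I_m | [&& e.1 < e.2, e.1 != i & e.2 != i]%N)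
      (shift_at x i k e.2 - shift_at x i k e.1)
    = \prod_(e : 'I_m * 'I_m | [&& e.1 < e.2, e.1 != i & e.2 != i]%N) (x e.2 - x e.1).
  apply: eq_bigr => e /and3P[_ /negPf e1 /negPf e2].
  by rewrite /shift_at e1 e2.
ring.
Qed.

Lemma vander_val_eq0 x i j : i != j -> x i = x j -> vander_val x = 0.
Proof.
move=> ij xij; apply/eqP/prodf_eq0.
have [lt|gt|/val_inj e] := ltngtP i j; last by rewrite e eqxx in ij.
  by exists (i, j); rewrite //= xij subrr.
by exists (j, i); rewrite //= xij subrr.
Qed.

Lemma vander_val_neq0 x : injective x -> vander_val x != 0.
Proof.
move=> x_inj; apply/prodf_neq0 => -[a b] /= lt; rewrite subr_eq0.
by apply: contraTneq lt => /x_inj ->; rewrite ltnn.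
Qed.

Lemma shift_atE l i k : (k <= l i)%N ->
  (fun j => ((l - U_(i) *+ k)%MM j)%:R : F) =1 shift_at (fun j => (l j)%:R) i k.
Proof.
move=> le j; rewrite mnmBE mulmnE mnm1E eq_sym /shift_at.
by case: eqP => [->|_]; rewrite ?mul1n ?mul0n ?subn0 // natrB.
Qed.

(** Multiplication by the power sum of degree k lowers one exponent by k; the resulting quotients of
    factorials and of Vandermonde values are the two factors of [hook_weight]. The remaining fixed
    points give the degree formula. *)
Lemma staircase_coef_rec ks r l : (\sum_i l i = \sum_(i < m) i + sumn ks + r)%N ->
  (staircase_coef (ks ++ nseq r 1) l)%:~R * (\prod_i (l i)`!)%N%:R
    = r`!%:R * vander_val (fun i => (l i)%:R : F)
      * frobenius_rec ks (fun i => (l i)%:R).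
Proof.
elim: ks l => [|k ks IHks] l lr.
  rewrite addn0 in lr; have := congr1 (fun z : int => z%:~R : F) (staircase_coef_nseq lr).
  rewrite !rmorphM /= !rmorph_nat mulr1 => ->; congr (_ * _).
  rewrite rmorph_prod; apply: eq_bigr => e _.
  by rewrite rmorphB /= !rmorph_nat.
have [/injectiveP l_inj|/injectivePn[i [j ij lij]]] := boolP (injectiveb l); last first.
  rewrite (staircase_coef_eq0 _ ij lij) mul0r (vander_val_eq0 ij) ?mulr0 ?mul0r //.
  by rewrite lij.
have -> : staircase_coef ((k :: ks) ++ nseq r 1) l
    = \sum_(i < m) if (k <= l i)%N
        then staircase_coef (ks ++ nseq r 1) (l - U_(i) *+ k)%MM else 0.
  rewrite /staircase_coef -mcoeffM_power_sum; congr (_@__).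
  by rewrite /power_sum_prod /= big_cons; ring.
rewrite rmorph_sum /= mulr_suml mulr_sumr; apply: eq_bigr => i _.
(* An exponent below k cannot be lowered; on the other side the first product of [hook_weight]
   contains the factor 0. *)
case: leqP => [le|lt]; last first.
  rewrite mul0r [hook_weight _ _ _](_ : _ = 0) ?mul0r ?mulr0 //.
  by rewrite /hook_weight (bigD1 (Ordinal lt)) //= subrr !mul0r.
have lr' : (\sum_j (l - U_(i) *+ k)%MM j = \sum_(i < m) i + sumn ks + r)%N.
  apply/eqP; rewrite -(eqn_add2r k); apply/eqP.
  transitivity (\sum_j l j)%N; last by rewrite lr /=; lia.
  rewrite (bigD1 i) //= [RHS](bigD1 i) //= mnmBE mulmnE mnm1E eqxx mul1n addnAC subnK //.
  congr (_ + _)%N; apply: eq_bigr => j /negPf ji.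
  by rewrite mnmBE mulmnE mnm1E eq_sym ji mul0n subn0.
have := IHks _ lr'; rewrite (eq_frobenius_rec _ (shift_atE le)).
have -> : vander_val (fun j => ((l - U_(i) *+ k)%MM j)%:R : F)
    = vander_val (shift_at (fun j => (l j)%:R) i k).
  by rewrite /vander_val; apply: eq_bigr => e _; rewrite !(shift_atE le).
have factE : (\prod_j (l j)`!)%N%:R
    = (\prod_j ((l - U_(i) *+ k)%MM j)`!)%N%:R * (l i ^_ k)%:R :> F.
  rewrite -natrM; congr (_%:R).
  rewrite (bigD1 i) //= [in RHS](bigD1 i) //= mulnAC; congr (_ * _)%N.
    by rewrite mnmBE mulmnE mnm1E eqxx mul1n mulnC ffact_fact.
  by apply: eq_bigr => j /negPf ji; rewrite mnmBE mulmnE mnm1E eq_sym ji mul0n subn0.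
rewrite factE mulrA => ->.
have := vander_val_shift (fun j => (l j)%:R) i k.
set D := \prod_(j | j != i) (_ - _); set N := \prod_(j | j != i) (_ - _ - _) => eDN.
have D0 : D != 0.
  apply/prodf_neq0 => j ji; rewrite subr_eq0 eqr_nat.
  by apply: contra ji => /eqP/l_inj ->.
have -> : hook_weight k (fun j => (l j)%:R) i = (l i ^_ k)%:R * (N / D).
  rewrite /hook_weight prodf_div; congr (_ * _).
  have e : iota 0 k = index_iota 0 k by rewrite /index_iota subn0.
  by rewrite natr_ffact big_map e big_mkord.
rewrite (_ : vander_val (shift_at _ i k) = vander_val (fun j => (l j)%:R : F) * (N / D)).
  by ring.
by apply: (mulfI D0); rewrite eDN mulrCA [D * _]mulrC divfK // mulrC.
Qed.

End Recursion.

Lemma sum_ord_injective m (l : 'I_m -> nat) : injective l ->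
  (\sum_(i < m) i <= \sum_i l i)%N.
Proof.
move=> l_inj; pose s := sort leq [seq l i | i : 'I_m].
have ss : sorted ltn s.
  rewrite ltn_sorted_uniq_leq sort_uniq map_inj_uniq ?enum_uniq //=.
  by apply: sort_sorted; apply: leq_total.
have sz : size s = m by rewrite size_sort size_map -cardE card_ord.
have -> : (\sum_i l i = \sum_(i < m) nth 0 s i)%N.
  rewrite -big_enum -(big_map l predT id) /= -sumnE.
  have /perm_sumn <- : perm_eq s [seq l i | i : 'I_m] by rewrite perm_sort.
  by rewrite sumnE (big_nth 0%N) sz big_mkord.
apply: leq_sum => i _; have: (i < size s)%N by rewrite sz.
case: i => i _ /=; elim: i => // i IHi lti.
apply: leq_ltn_trans (IHi (ltnW lti)) _.
by apply: (sorted_ltn_nth ltn_trans) => //; rewrite inE ltnW.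
Qed.

(** Accounts for the convention that the character is 0 when the cycles are too long. Steps of
    nonzero weight keep the nodes distinct natural numbers, whose sum is at least 0 + ... + (m - 1),
    so the total removed is bounded. *)
Lemma frobenius_rec_eq0 (F : numFieldType) m ks (l : 'X_{1..m}) : injective l ->
    (\sum_i l i < \sum_(i < m) i + sumn ks)%N ->
  frobenius_rec ks (fun i => (l i)%:R : F) = 0.
Proof.
elim: ks l => [|k ks IHks] l l_inj /= lt.
  by move: lt; rewrite addn0 ltnNge sum_ord_injective.
rewrite big1 // => i _; have [lti|le] := ltnP (l i) k.
  by rewrite /hook_weight (bigD1 (Ordinal lti)) //= subrr !mul0r.
have [/existsP[j /andP[ji /eqP e]]|] := boolP [exists j, (j != i) && (l j == (l i - k)%N)].
  rewrite [hook_weight _ _ _](_ : _ = 0) ?mul0r // /hook_weight [X in _ * X](bigD1 j) //=.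
  by rewrite e natrB // subrr !mul0r mulr0.
move=> /existsPn noex; rewrite -(eq_frobenius_rec _ (shift_atE F le)) IHks ?mulr0 //.
  move=> a b; rewrite !mnmBE !mulmnE !mnm1E.
  have [ia|nai] := eqVneq i a; have [ib|nbi] := eqVneq i b; rewrite ?mul1n ?mul0n ?subn0.
  - by rewrite -ia.
  - by move=> e; have := noex b; rewrite eq_sym nbi -e ia eqxx.
  - by move=> e; have := noex a; rewrite eq_sym nai e ib eqxx.
  - exact: l_inj.
suff e : (\sum_j (l - U_(i) *+ k)%MM j + k = \sum_j l j)%N.
  by rewrite -(ltn_add2r k) -addnA [(_ + k)%N in ltnRHS]addnC e.
rewrite (bigD1 i) //= [RHS](bigD1 i) //= mnmBE mulmnE mnm1E eqxx mul1n addnAC subnK //.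
congr (_ + _)%N; apply: eq_bigr => j /negPf ji.
by rewrite mnmBE mulmnE mnm1E eq_sym ji mul0n subn0.
Qed.

Lemma shifted_rows_inj lam : is_partition lam -> injective (shifted_rows lam).
Proof.
move=> lamP i j; rewrite !mnmE => e; apply: val_inj; have := e.
wlog lt : i j e / (i < j)%N => [hw|].
  by case: (ltngtP i j) => // lt h; [apply: hw|apply/esym/hw].
have : (nth 0 lam (rev_ord i) <= nth 0 lam (rev_ord j))%N.
  by apply: (partition_nth lamP); apply: leq_sub2l; apply: ltnW.
by move: lt; lia.
Qed.

Lemma normalized_character_rec (F : numFieldType) lam ks (g : 'S_(sumn lam)) :
    is_partition lam -> ((sumn ks <= sumn lam)%N -> has_cycle_type ks g) ->
  normalized_character F ks g = frobenius_rec ks (fun i => (shifted_rows lam i)%:R : F).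
Proof.
move=> lamP gks; rewrite normalized_characterE //.
have l_inj := shifted_rows_inj lamP.
case: leqP => [le|lt]; last first.
  by rewrite frobenius_rec_eq0 // sum_shifted_rows addnC ltn_add2l.
set n := sumn lam; set l := shifted_rows lam; set r := (n - sumn ks)%N.
rewrite young_class_funV.
have lr : (\sum_i l i = \sum_(i < size lam) i + sumn ks + r)%N.
  by rewrite sum_shifted_rows -addnA subnKC // addnC.
have ln : (\sum_i l i = \sum_(i < size lam) i + sumn [::] + n)%N.
  by rewrite sum_shifted_rows addn0 addnC.
(* The formula is taken for [g] and for the identity: their quotient cancels the factorials of the
   exponents and the Vandermonde value. *)
have := staircase_coef_rec F lr; have := staircase_coef_rec F ln; rewrite mulr1.
have type1 : cycle_type (1%g : 'S_n) = nseq n 1%N.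
  have all1 : all (pred1 1%N) (cycle_type (1%g : 'S_n)).
    apply/allP => k /mapP[A]; rewrite mem_enum => /imsetP[a _ ->] ->.
    by rewrite porbit.unlock cycle1 imset_set1 cards1.
  have := sumn_cycle_type (1%g : 'S_n); rewrite (all_pred1P _ _ all1).
  by rewrite sumn_nseq mul1n => ->.
have coefE (h : 'S_n) ks' : perm_eq (cycle_type h) ks' ->
    staircase_coef ks' l = frobenius_coef l h.
  move=> pe; rewrite /staircase_coef /frobenius_coef perm_power_sumE.
  by rewrite /power_sum_prod (perm_big _ pe).
rewrite (coefE g _ (gks le)) /= (coefE 1%g) ?type1 //.
have := congr1 (fun z : int => z%:~R : F) (frobenius_young lamP g).
rewrite !rmorphM /= rmorph_nat -/l; move: (frobenius_coef l g) (frobenius_coef _ 1) => a b.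
have V0 : vander_val (fun i => (l i)%:R : F) != 0.
  by apply: vander_val_neq0 => i j /eqP; rewrite eqr_nat => /eqP/l_inj.
have P0 : (\prod_i (l i)`!)%N%:R != 0 :> F.
  by rewrite pnatr_eq0 -lt0n prodn_gt0 // => i; apply: fact_gt0.
have n0 : n`!%:R != 0 :> F by rewrite pnatr_eq0 -lt0n fact_gt0.
have r0 : r`!%:R != 0 :> F by rewrite pnatr_eq0 -lt0n fact_gt0.
have nK : (n ^_ sumn ks)%:R = n`!%:R / r`!%:R :> F.
  by apply: (mulIf r0); rewrite divfK // -natrM ffact_fact.
rewrite nK; move: V0 P0 n0 r0; move: (vander_val _) (_%:R) (n`!%:R) (r`!%:R).
move=> V P N Rr V0 P0 N0 Rr0 e1 e2 e3.
have b0 : b%:~R != 0 :> F.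
  by apply: contra (mulf_neq0 N0 V0) => /eqP b0; rewrite -e2 b0 mul0r.
apply: (mulfI (mulf_neq0 (mulf_neq0 P0 b0) Rr0)).
transitivity (P * (b%:~R * (young_class_fun lam g)%:~R)); first by field; rewrite N0 Rr0.
rewrite -e1 mulrCA [P * _]mulrC e3.
transitivity (N * V * Rr * frobenius_rec ks (fun i => (l i)%:R)); first by ring.
by rewrite -e2; ring.
Qed.

(** * Expansions at infinity *)

(* The variable of these power series is t = 1/z. *)
Definition series (R : comNzRingType) := nat -> R.

Section SeriesRing.

Variable R : comNzRingType.
Implicit Types (s u v : series R) (p q : {poly R}).

HB.instance Definition _ := gen_eqMixin (series R).
HB.instance Definition _ := gen_choiceMixin (series R).

Definition series_of_poly p : series R := fun e => p`_e.
Definition series_trunc N s : {poly R} := \poly_(i < N) s i.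

Lemma series_truncK N s e : (e < N)%N -> (series_trunc N s)`_e = s e.
Proof. by move=> lt; rewrite coef_poly lt. Qed.

Definition add_series s u : series R := fun e => s e + u e.
Definition opp_series s : series R := fun e => - s e.
Definition mul_series s u : series R := fun e => \sum_(i < e.+1) s i * u (e - i)%N.

(** A coefficient of a product only sees truncations, so the laws of multiplication come from
    polynomials. *)
Lemma mul_seriesE s u e N : (e < N)%N ->
  mul_series s u e = (series_trunc N s * series_trunc N u)`_e.
Proof.
move=> lt; rewrite coefM; apply: eq_bigr => i _.
have lei : (i <= e)%N by rewrite -ltnS.
by rewrite !series_truncK // ?(leq_ltn_trans lei) // (leq_ltn_trans (leq_subr _ _)).
Qed.

Lemma add_seriesA : associative add_series.
Proof. by move=> s u v; apply/funext => e; apply: addrA. Qed.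
Lemma add_seriesC : commutative add_series.
Proof. by move=> s u; apply/funext => e; apply: addrC. Qed.
Lemma add_0series : left_id (fun=> 0) add_series.
Proof. by move=> s; apply/funext => e; apply: add0r. Qed.
Lemma add_Nseries : left_inverse (fun=> 0) opp_series add_series.
Proof. by move=> s; apply/funext => e; apply: addNr. Qed.

HB.instance Definition _ := GRing.isZmodule.Build (series R)
  add_seriesA add_seriesC add_0series add_Nseries.

Lemma mul_seriesC : commutative mul_series.
Proof. by move=> s u; apply/funext => e; rewrite !(mul_seriesE _ _ (ltnSn e)) mulrC. Qed.

Lemma mul_seriesA : associative mul_series.
Proof.
move=> s u v; apply/funext => e.
have coefE (w w' : series R) p : (forall i, (i < e.+1)%N -> w i = p`_i) ->
    mul_series w w' e = (p * series_trunc e.+1 w')`_e.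
  move=> wp; rewrite /mul_series coefM; apply: eq_bigr => i _.
  by rewrite wp // series_truncK // ltnS leq_subr.
rewrite (coefE (mul_series s u) v (series_trunc e.+1 s * series_trunc e.+1 u)).
  rewrite mul_seriesC (coefE _ _ (series_trunc e.+1 u * series_trunc e.+1 v)).
    by rewrite mulrC mulrA.
  by move=> i lti; apply: mul_seriesE.
by move=> i lti; apply: mul_seriesE.
Qed.

Lemma mul_1series : left_id (series_of_poly 1) mul_series.
Proof.
move=> s; apply/funext => e; rewrite /mul_series big_ord_recl /= subn0.
rewrite /series_of_poly coef1 mul1r big1 ?addr0 // => i _.
by rewrite coef1 mul0r.
Qed.

Lemma mul_seriesDl : left_distributive mul_series add_series.
Proof.
move=> s u v; apply/funext => e; rewrite /add_series /mul_series -big_split /=.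
by apply: eq_bigr => i _; rewrite mulrDl.
Qed.

Lemma series1_neq0 : series_of_poly 1 != (fun=> 0) :> series R.
Proof.
apply/eqP => /(congr1 (fun s : series R => s 0%N)).
by rewrite /series_of_poly coef1 => /eqP; rewrite oner_eq0.
Qed.

HB.instance Definition _ := GRing.Zmodule_isComNzRing.Build (series R)
  mul_seriesA mul_seriesC mul_1series mul_seriesDl series1_neq0.

Lemma coef_series1 e : (1 : series R) e = (e == 0%N)%:R.
Proof. by rewrite -[LHS]/(series_of_poly 1 e) /series_of_poly coef1. Qed.
Lemma coef_seriesD s u e : (s + u) e = s e + u e. Proof. by []. Qed.
Lemma coef_seriesM s u e : (s * u) e = \sum_(i < e.+1) s i * u (e - i)%N.
Proof. by []. Qed.
Lemma coef_series_sum (I : Type) (r : seq I) (P : pred I) (F : I -> series R) e :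
  (\sum_(i <- r | P i) F i) e = \sum_(i <- r | P i) F i e.
Proof. by elim/big_rec2: _ => // i x y _ <-. Qed.

Lemma series_of_poly_is_zmod : zmod_morphism series_of_poly.
Proof. by move=> p q; apply/funext => e; rewrite /series_of_poly coefB. Qed.
Lemma series_of_poly_is_monoid : monoid_morphism series_of_poly.
Proof. by split=> // p q; apply/funext => e; rewrite /series_of_poly coefM. Qed.

HB.instance Definition _ := GRing.isZmodMorphism.Build {poly R} (series R)
  series_of_poly series_of_poly_is_zmod.
HB.instance Definition _ := GRing.isMonoidMorphism.Build {poly R} (series R)
  series_of_poly series_of_poly_is_monoid.

(** The expansion of 1 / (1 - y t), that is of z / (z - y). *)
Definition geometric (y : R) : series R := fun e => y ^+ e.

Lemma geometricP y : series_of_poly (1 - y%:P * 'X) * geometric y = 1.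
Proof.
apply/funext => e; rewrite coef_series1 coef_seriesM /series_of_poly.
case: e => [|e]; first by rewrite big_ord1 coefB coefMX coef1 subr0 mulr1.
rewrite !big_ord_recl big1 ?addr0 => [|i _].
  rewrite /geometric !coefB !coefMX !coefC /= subr0 mul1r sub0r subn0.
  by rewrite /bump /= subn1 mulNr -exprS subrr.
by rewrite coefB coefMX coefC coef1 /= subr0 mul0r.
Qed.

Lemma coef_series_XnM k s e : (series_of_poly 'X^k * s) (k + e)%N = s e.
Proof.
have lt : (k < (k + e).+1)%N by rewrite ltnS leq_addr.
rewrite coef_seriesM (bigD1 (Ordinal lt)) //= /series_of_poly coefXn eqxx mul1r addKn.
rewrite big1 ?addr0 // => i; rewrite -(inj_eq val_inj) coefXn => /negPf /= ->.
by rewrite mul0r.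
Qed.

Lemma coef_seriesCM a s e : (series_of_poly a%:P * s) e = a * s e.
Proof.
rewrite coef_seriesM big_ord_recl big1 ?addr0 => [|i _].
  by rewrite /series_of_poly coefC subn0.
by rewrite /series_of_poly coefC mul0r.
Qed.

Lemma coef_series_XnM_lt k s e : (e < k)%N -> (series_of_poly 'X^k * s) e = 0.
Proof.
move=> lt; rewrite coef_seriesM big1 // => i _.
rewrite /series_of_poly coefXn ltn_eqF ?mul0r //.
by apply: leq_ltn_trans lt; rewrite -ltnS.
Qed.

End SeriesRing.

Section Reversal.

Variable F : fieldType.
Implicit Types (p q : {poly F}).

(* X^D p(1/X), for p of degree at most D. *)
Definition revp D p : {poly F} := \sum_(i < D.+1) p`_i *: 'X^(D - i).

Lemma revp_is_linear D : linear (revp D).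
Proof.
move=> a p q; rewrite /revp scaler_sumr -big_split; apply: eq_bigr => i _ /=.
by rewrite coefD coefZ scalerDl scalerA.
Qed.
HB.instance Definition _ D :=
  GRing.isLinear.Build F {poly F} {poly F} _ (revp D) (revp_is_linear D).

Lemma revpXn D k : (k <= D)%N -> revp D 'X^k = 'X^(D - k).
Proof.
rewrite -ltnS => lt; rewrite /revp (bigD1 (Ordinal lt)) //= coefXn eqxx scale1r.
rewrite big1 ?addr0 // => i; rewrite -(inj_eq val_inj) coefXn => /negPf /= ->.
by rewrite scale0r.
Qed.

Lemma revpM D D' p q : (size p <= D.+1)%N -> (size q <= D'.+1)%N ->
  revp (D + D') (p * q) = revp D p * revp D' q.
Proof.
have polyE N (r : {poly F}) : (size r <= N.+1)%N -> r = \sum_(i < N.+1) r`_i *: 'X^i.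
  move=> le; rewrite -poly_def; apply/polyP => i; rewrite coef_poly.
  by case: ltnP => // le'; rewrite nth_default // (leq_trans le).
move=> sp sq; rewrite {1}(polyE D p) // {1}(polyE D' q) // mulr_suml raddf_sum.
rewrite /revp mulr_suml; apply: eq_bigr => i _; rewrite !mulr_sumr raddf_sum.
apply: eq_bigr => j _; rewrite /= -scalerAl -scalerAr !linearZ /= -exprD.
have lei : (i <= D)%N by rewrite -ltnS.
have lej : (j <= D')%N by rewrite -ltnS.
rewrite revpXn ?leq_add // -scalerAl -scalerAr -exprD; congr (_ *: (_ *: 'X^_)).
by lia.
Qed.

Lemma revp_prod (s : seq F) :
  revp (size s) (\prod_(a <- s) ('X - a%:P)) = \prod_(a <- s) (1 - a%:P * 'X).
Proof.
elim: s => [|a s IHs]; first by rewrite !big_nil -(expr0 'X) revpXn.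
rewrite !big_cons -IHs -[size (a :: s)]/(1 + size s)%N revpM ?size_XsubC //.
  congr (_ * _); rewrite /revp !big_ord_recl big_ord0 !coefB !coefX !coefC /=.
  by rewrite subn0 subnn subr0 scale1r sub0r scaleNr -mul_polyC expr1 expr0; ring.
by rewrite size_prod_XsubC.
Qed.

Lemma revp_size D p : (size (revp D p) <= D.+1)%N.
Proof.
apply: leq_trans (size_sum _ _ _) _; apply/bigmax_leqP => i _.
by rewrite (leq_trans (size_scale_leq _ _)) // size_polyXn ltnS leq_subr.
Qed.

End Reversal.

(** * Partial fractions and residues *)

Section PartialFraction.

Variables (F : fieldType) (m : nat) (x : 'I_m -> F).
Hypothesis x_inj : injective x.

Definition nodes_except i := \prod_(j | j != i) ('X - (x j)%:P).

Lemma nodes_except_horner i : (nodes_except i).[x i] = \prod_(j | j != i) (x i - x j).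
Proof. by rewrite horner_prod; apply: eq_bigr => j _; rewrite hornerXsubC. Qed.

Lemma nodes_except_horner_neq i i' : i' != i -> (nodes_except i).[x i'] = 0.
Proof.
by move=> ne; rewrite horner_prod (bigD1 i') //= hornerXsubC subrr mul0r.
Qed.

Lemma size_nodes (P : pred 'I_m) :
  size (\prod_(j | P j) ('X - (x j)%:P)) = #|P|.+1.
Proof. by rewrite -big_filter size_prod_XsubC size_filter -sum1_count sum1_card. Qed.

Lemma partial_fraction (P : {poly F}) k : (size P <= (k + m).+1)%N ->
  exists2 A : {poly F}, (size A <= k.+1)%N &
    P = A * \prod_j ('X - (x j)%:P)
      + \sum_i (P.[x i] / \prod_(j | j != i) (x i - x j)) *: nodes_except i.
Proof.
set Q := \prod_j _ => sP; have sQ : size Q = m.+1 by rewrite size_nodes card_ord.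
have Q0 : Q != 0 by rewrite -size_poly_eq0 sQ.
exists (P %/ Q); first by rewrite size_divp // sQ /= leq_subLR addnS addnC.
rewrite {1}(divp_eq P Q); congr (_ + _); apply/eqP; rewrite -subr_eq0; apply/eqP.
apply: (@roots_geq_poly_eq0 _ _ [seq x i | i : 'I_m]).
- apply/allP => _ /mapP[i _ ->]; rewrite rootE hornerD hornerN horner_sum.
  rewrite (bigD1 i) //= [X in _ - (_ + X)]big1 => [|i' ne]; last first.
    by rewrite hornerZ nodes_except_horner_neq ?mulr0 // eq_sym.
  rewrite hornerZ nodes_except_horner addr0 divfK; last first.
    by apply/prodf_neq0 => j; rewrite subr_eq0 eq_sym (inj_eq x_inj).
  have Qi : Q.[x i] = 0.
    by rewrite horner_prod (bigD1 i) //= hornerXsubC subrr mul0r.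
  by rewrite {2}(divp_eq P Q) hornerD hornerM Qi mulr0 add0r subrr.
- by rewrite map_inj_uniq ?enum_uniq.
rewrite size_map -cardE card_ord.
rewrite (leq_trans (size_polyD _ _)) // geq_max -ltnS -sQ ltn_modp Q0 size_polyN.
rewrite (leq_trans (size_sum _ _ _)) //; apply/bigmax_leqP => i _.
rewrite (leq_trans (size_scale_leq _ _)) // size_nodes cardC1 card_ord.
by rewrite prednK // (leq_ltn_trans (leq0n i)).
Qed.

End PartialFraction.

Section HookSeries.

Variables (F : numFieldType) (m : nat).
Implicit Types (x : 'I_m -> F) (c : F).

Local Notation lin a := (series_of_poly (1 - a%:P * 'X)).

(** In the product of k shifted copies of H the node factors telescope. This numerator and the
    denominator prod_j (z - (x_j - c)) remain. *)
Definition hook_num x c k : {poly F} :=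
  \prod_(a < k) ('X - (a%:R - c)%:P) * \prod_j ('X - (x j - c + k%:R)%:P).

(* z^k times this series, at t = 1/z, is H(z+c) H(z+c-1) ... H(z+c-k+1) for
   H(z) = z prod_j (z-1-x_j)/(z-x_j). *)
Definition hook_series x c k : series F :=
  \prod_(a < k) lin (a%:R - c) * \prod_j (lin (x j - c + k%:R) * geometric (x j - c)).

Lemma shift_inj x c : injective x -> injective (fun j => x j - c).
Proof. by move=> x_inj i j /addIr/x_inj. Qed.

Lemma prod_lin (I : finType) (P : pred I) (y : I -> F) N : #|P| = N ->
  series_of_poly (revp N (\prod_(j | P j) ('X - (y j)%:P))) = \prod_(j | P j) lin (y j).
Proof.
move=> <-; have -> : \prod_(j | P j) ('X - (y j)%:P)
    = \prod_(a <- [seq y j | j <- enum P]) ('X - a%:P).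
  by rewrite big_map big_enum.
have -> : #|P| = size [seq y j | j <- enum P] by rewrite size_map -cardE.
by rewrite revp_prod rmorph_prod big_map big_enum.
Qed.

Lemma hook_seriesE x c k :
  hook_series x c k
    = series_of_poly (revp (k + m) (hook_num x c k)) * \prod_j geometric (x j - c).
Proof.
rewrite /hook_num revpM.
- rewrite rmorphM /= /hook_series big_split /= -!mulrA; congr (_ * (_ * _)).
    by rewrite -(prod_lin _ (card_ord k)).
  by rewrite -(prod_lin _ (card_ord m)).
- by rewrite -big_enum size_prod_XsubC -cardE card_ord.
- by rewrite -big_enum size_prod_XsubC -cardE card_ord.
Qed.

Lemma size_hook_num x c k : size (hook_num x c k) = (k + m).+1.
Proof.
rewrite /hook_num size_mul ?monic_neq0 ?monic_prod_XsubC //.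
by rewrite -!big_enum !size_prod_XsubC -!cardE !card_ord addnS.
Qed.

(** The node factor with j = i contributes -k, and the other factors are those of [hook_weight]. *)
Lemma hook_residue x c k i :
  (hook_num x c k).[x i - c] / \prod_(j | j != i) ((x i - c) - (x j - c))
    = - (k%:R * hook_weight k x i).
Proof.
rewrite /hook_num hornerM !horner_prod (bigD1 i (P := predT)) //= hornerXsubC.
rewrite /hook_weight prodf_div.
have -> : \prod_(a < k) ('X - (a%:R - c)%:P).[x i - c] = \prod_(a < k) (x i - a%:R).
  by apply: eq_bigr => a _; rewrite hornerXsubC; ring.
have -> : \prod_(j | j != i) ('X - (x j - c + k%:R)%:P).[x i - c]
        = \prod_(j | j != i) (x i - k%:R - x j).
  by apply: eq_bigr => j _; rewrite hornerXsubC; ring.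
have -> : \prod_(j | j != i) (x i - c - (x j - c)) = \prod_(j | j != i) (x i - x j).
  by apply: eq_bigr => j _; ring.
move: (\prod_(a < k) _) (\prod_(j | _) _) (\prod_(j | _) _) => A N D.
by rewrite opprD addNKr; ring.
Qed.

Lemma lin_geometric (y : F) : lin y * geometric y = 1.
Proof. exact: geometricP. Qed.

(** Since z^k is factored out, indices 0 to k carry the polynomial part, and index k + 1 + e is the
    coefficient of z^(-1-e), to which each simple pole contributes its residue times a power of the
    pole. *)
Lemma coef_hook_series x c k e : injective x ->
  hook_series x c k (k.+1 + e)%N
    = \sum_i - (k%:R * hook_weight k x i) * (x i - c) ^+ e.
Proof.
move=> x_inj; pose y j := x j - c.
have y_inj : injective y := shift_inj x_inj.
have [A sA HA] := @partial_fraction _ m y y_inj (hook_num x c k) k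
  (eq_leq (size_hook_num x c k)).
have polarE i : series_of_poly (revp (k + m) (nodes_except y i)) * \prod_j geometric (y j)
    = series_of_poly 'X^(k.+1) * geometric (y i).
  have m_gt0 : (0 < m)%N by apply: leq_ltn_trans (ltn_ord i).
  have -> : (k + m = k.+1 + m.-1)%N by rewrite addSnnS prednK.
  rewrite -[nodes_except y i]mul1r revpM ?size_poly1 //; last first.
    by rewrite size_nodes cardC1 card_ord.
  rewrite -{1}(expr0 'X) revpXn // subn0 rmorphM -mulrA; congr (_ * _).
  rewrite /= (@prod_lin _ (predC1 i)) ?cardC1 ?card_ord //.
  rewrite [X in _ * X](bigD1 i) //= mulrCA -big_split /= big1 ?mulr1 //.
  by move=> j _; apply: lin_geometric.
have -> : hook_series x c k = series_of_poly (revp k A)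
   + \sum_i series_of_poly (- (k%:R * hook_weight k x i))%:P
            * (series_of_poly 'X^(k.+1) * geometric (y i)).
  rewrite hook_seriesE {1}HA raddfD rmorphD mulrDl; congr (_ + _).
    rewrite /= revpM //; last by rewrite size_nodes card_ord.
    rewrite rmorphM /= (prod_lin _ (card_ord m)) -mulrA -big_split /= big1 ?mulr1 //.
    by move=> j _; apply: lin_geometric.
  rewrite /= (raddf_sum (revp _)) rmorph_sum /= mulr_suml. apply: eq_bigr => i _ /=.
  by rewrite linearZ /= -mul_polyC rmorphM -mulrA polarE hook_residue.
rewrite coef_seriesD coef_series_sum {1}/series_of_poly nth_default ?add0r; last first.
  by apply: leq_trans (revp_size _ _) _; rewrite leq_addr.
apply: eq_bigr => i _; rewrite coef_seriesCM coef_series_XnM.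
by rewrite /geometric.
Qed.

(** Only the factors of node i change. With u = z - (x_i - c), the identity behind it is u (u + k' -
    k) = (u - k) (u + k') + k k'. *)
Lemma hook_series_shift x c k k' i :
  hook_series (shift_at x i k') c k
    = hook_series x c k
      * (1 + (series_of_poly 'X^2 * geometric (x i - c + k%:R)
              * geometric (x i - c - k'%:R)) *+ (k * k')).
Proof.
rewrite /hook_series (bigD1 i) //= [in RHS](bigD1 i) //= !mulrA.
rewrite (eq_bigr (fun j => lin (x j - c + k%:R) * geometric (x j - c))); last first.
  by move=> j /negPf ji; rewrite /shift_at ji.
set R := \prod_(j | j != i) _; set A := \prod_(a < k) _.
rewrite /shift_at eqxx; set y := x i - c.
have -> : x i - k'%:R - c + k%:R = y - k'%:R + k%:R by rewrite /y; ring.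
have -> : x i - k'%:R - c = y - k'%:R by rewrite /y; ring.
rewrite -!mulrA; congr (_ * _); rewrite !mulrA [RHS]mulrAC; congr (_ * _).
have g0 := lin_geometric y; have g1 := lin_geometric (y + k%:R).
have g2 := lin_geometric (y - k'%:R).
have key : lin y * lin (y - k'%:R + k%:R)
    = lin (y + k%:R) * lin (y - k'%:R) + series_of_poly 'X^2 *+ (k * k').
  rewrite -!rmorphM -rmorphMn -rmorphD /=; congr series_of_poly.
  rewrite -[_ *+ (k * k')]mulr_natl natrM !polyCD !polyCN -!polyC_natr; ring.
move: g0 g1 g2 key; move: (geometric y) (geometric (y + _)) (geometric (y - _)).
move: (lin y) (lin (y + _)) (lin (y - k'%:R)) (lin (y - _ + _)) (series_of_poly 'X^2).
move=> L0 L1 L2 L3 T G0 G1 G2 g0 g1 g2 key.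
have -> : L3 = G0 * (L1 * L2 + T *+ (k * k')).
  by rewrite -key mulrA [G0 * _]mulrC g0 mul1r.
rewrite -(mulr_natl T) -(mulr_natl (T * G1 * G2)); move: (k * k')%:R => K.
transitivity (G0 * L1 * (L2 * G2) + K * T * G0 * G2); first by ring.
transitivity (G0 * L1 + K * T * G0 * G2 * (L1 * G1)); last by ring.
by rewrite g1 g2 !mulr1.
Qed.

Lemma hook_series_prod x c k :
  hook_series x c k = \prod_(a < k) hook_series x (c - a%:R) 1.
Proof.
elim: k => [|k IHk].
  rewrite /hook_series !big_ord0 mul1r big1 // => j _.
  by rewrite addr0 lin_geometric.
rewrite big_ord_recr /= -IHk /hook_series big_ord_recr big_ord_recr big_ord0 /= mul1r.
rewrite -!mulrA; congr (_ * _); rewrite !mulrA [RHS]mulrAC -mulrA mulrC.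
rewrite [RHS]mulrA -big_split /=; congr (_ * _); last first.
  by congr (series_of_poly (1 - _%:P * 'X)); ring.
apply: eq_bigr => j _.
have -> : x j - (c - k%:R) = x j - c + k%:R by ring.
have -> : x j - c + k.+1%:R = x j - c + k%:R + 1 by rewrite -addn1 natrD addrA.
have := lin_geometric (x j - c + k%:R).
move: (lin (x j - c + k%:R)) (geometric (x j - c + k%:R)) => L G LG.
move: (lin _) (geometric _) => L' G'.
by transitivity (L' * G' * (L * G)); [rewrite LG mulr1 | ring].
Qed.

Lemma coef0_hook_series x c k : hook_series x c k 0%N = 1.
Proof.
have mul0 (s u : series F) : (s * u) 0%N = s 0%N * u 0%N.
  by rewrite coef_seriesM big_ord1.
have lin0 (a : F) : (lin a) 0%N = 1.
  by rewrite /series_of_poly coefB coefMX coef1 subr0.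
have prod0 (I : finType) (G : I -> series F) :
    (forall i, G i 0%N = 1) -> (\prod_i G i) 0%N = 1.
  move=> G0; elim/big_rec: _ => [|i s _ s0]; first by rewrite coef_series1.
  by rewrite mul0 G0 s0 mulr1.
rewrite /hook_series mul0 !prod0 ?mulr1 // => j.
by rewrite mul0 lin0 /geometric expr0 mulr1.
Qed.

(** Each node contributes -1 whatever its position; this is why the centre is later taken to be zeta
    + m. *)
Lemma coef1_hook_series x c : hook_series x c 1 1%N = c - m%:R.
Proof.
have mul1 (s u : series F) : s 0%N = 1 -> u 0%N = 1 ->
    (s * u) 0%N = 1 /\ (s * u) 1%N = s 1%N + u 1%N.
  move=> s0 u0; rewrite !coef_seriesM big_ord1 big_ord_recl big_ord1 /=.
  by rewrite s0 u0 !mul1r mulr1 addrC.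
have lin0 (a : F) : (lin a) 0%N = 1 by rewrite /series_of_poly coefB coefMX coef1 subr0.
have lin1 (a : F) : (lin a) 1%N = - a.
  by rewrite /series_of_poly coefB coefMX !coefC /= sub0r.
have prod1 (I : finType) (G : I -> series F) :
    (forall i, G i 0%N = 1) -> (\prod_i G i) 0%N = 1 /\ (\prod_i G i) 1%N = \sum_i G i 1%N.
  move=> G0; elim/big_rec2: _ => [|i s t _ [t0 t1]].
    by rewrite !coef_series1.
  by rewrite -t1; apply: mul1.
have [node0 node1] : (forall j, (lin (x j - c + 1) * geometric (x j - c)) 0%N = 1) /\
    (forall j, (lin (x j - c + 1) * geometric (x j - c)) 1%N = -1).
  split=> j; have [e0 e1] := mul1 (lin (x j - c + 1)) _ (lin0 _) (expr0 (x j - c)) => //.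
  by rewrite e1 lin1 /geometric expr1; ring.
rewrite /hook_series big_ord1.
have [p0 p1] := prod1 _ (fun j => lin (x j - c + 1) * geometric (x j - c)) node0.
have [_ e] := mul1 (lin (0 - c)) (\prod_j (lin (x j - c + 1) * geometric (x j - c)))
  (lin0 _) p0.
rewrite e p1 lin1 (eq_bigr (fun=> -1)) //.
by rewrite sumr_const card_ord mulNrn; ring.
Qed.

End HookSeries.

(** * Positivity *)

Section NonnegPoly.

Variable F : numFieldType.

(* Polynomial functions with nonnegative coefficients in the variables v i with
   i in D. *)
Inductive nonneg_poly (I : Type) (D : I -> Prop) : ((I -> F) -> F) -> Prop :=
| nonneg_const a : 0 <= a -> nonneg_poly D (fun=> a)
| nonneg_var i : D i -> nonneg_poly D (fun v => v i)
| nonneg_add f g : nonneg_poly D f -> nonneg_poly D g ->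
    nonneg_poly D (fun v => f v + g v)
| nonneg_mul f g : nonneg_poly D f -> nonneg_poly D g ->
    nonneg_poly D (fun v => f v * g v).

Lemma eq_nonneg_poly (I : Type) (D : I -> Prop) f g :
  nonneg_poly D f -> f =1 g -> nonneg_poly D g.
Proof. by move=> Df /funext <-. Qed.

Lemma nonneg_poly_sum (I T : Type) (D : I -> Prop) (r : seq T) (P : pred T) f :
    (forall t, P t -> nonneg_poly D (f t)) ->
  nonneg_poly D (fun v => \sum_(t <- r | P t) f t v).
Proof.
move=> Df; elim: r => [|t r IHr].
  by apply: (eq_nonneg_poly (nonneg_const D (lexx 0))) => v; rewrite big_nil.
case Pt: (P t); last by apply: (eq_nonneg_poly IHr) => v; rewrite big_cons Pt.
by apply: (eq_nonneg_poly (nonneg_add (Df t Pt) IHr)) => v; rewrite big_cons Pt.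
Qed.

Lemma nonneg_poly_exp (I : Type) (D : I -> Prop) f n :
  nonneg_poly D f -> nonneg_poly D (fun v => f v ^+ n).
Proof.
move=> Df; elim: n => [|n IHn]; first exact: (nonneg_const D ler01).
by apply: (eq_nonneg_poly (nonneg_mul Df IHn)) => v; rewrite exprS.
Qed.

Lemma nonneg_poly_subst (I J : Type) (D : I -> Prop) (E : J -> Prop) f
    (h : I -> (J -> F) -> F) :
    nonneg_poly D f -> (forall i, D i -> nonneg_poly E (h i)) ->
  nonneg_poly E (fun v => f (fun i => h i v)).
Proof.
move=> Df Eh; elim: Df => [a a0|i Di|f1 f2 _ IH1 _ IH2|f1 f2 _ IH1 _ IH2].
- exact: nonneg_const.
- exact: Eh.
- exact: nonneg_add.
- exact: nonneg_mul.
Qed.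

Lemma nonneg_poly_weaken (I : Type) (D E : I -> Prop) f :
  nonneg_poly D f -> (forall i, D i -> E i) -> nonneg_poly E f.
Proof.
by move=> Df DE; apply: (nonneg_poly_subst Df) => i /DE; apply: nonneg_var.
Qed.

Definition with_extra (I : Type) (D : I -> Prop) (o : option I) : Prop :=
  if o is Some i then D i else True.

(** The extra variable will be the lowered node. Isolating its powers allows each of them to be
    summed over the nodes by [coef_hook_series]. *)
Lemma nonneg_poly_expand (I : Type) (D : I -> Prop) f :
    nonneg_poly (with_extra D) f ->
  exists (T : finType) (e : T -> nat) (G : T -> (I -> F) -> F),
    (forall t, nonneg_poly D (G t)) /\
    (forall v, f v = \sum_t v None ^+ e t * G t (fun i => v (Some i))).
Proof.
elim=> [a a0|[i|] Di|f1 f2 _ [T [e [G [DG fE]]]] _ [T' [e' [G' [DG' fE']]]]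
               |f1 f2 _ [T [e [G [DG fE]]]] _ [T' [e' [G' [DG' fE']]]]].
- exists unit, (fun=> 0%N), (fun=> fun=> a); split=> [_|v]; first exact: nonneg_const.
  by rewrite (big_pred1 tt) ?expr0 ?mul1r // => -[].
- exists unit, (fun=> 0%N), (fun=> fun u => u i); split=> [_|v]; first exact: nonneg_var.
  by rewrite (big_pred1 tt) ?expr0 ?mul1r // => -[].
- exists unit, (fun=> 1%N), (fun=> fun=> 1); split=> [_|v]; first exact: (nonneg_const D ler01).
  by rewrite (big_pred1 tt) ?expr1 ?mulr1 // => -[].
- exists (T + T')%type, (fun t => match t with inl t => e t | inr t => e' t end),
    (fun t => match t with inl t => G t | inr t => G' t end).
  by split=> [[]|v] //; rewrite big_sumType fE fE'.
exists (T * T')%type, (fun t => e t.1 + e' t.2)%N, (fun t u => G t.1 u * G' t.2 u).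
split=> [t|v]; first exact: nonneg_mul.
rewrite fE fE' big_distrlr pair_bigA /=; apply: eq_bigr => t _.
by rewrite exprD; ring.
Qed.

(** The coefficient is the divided difference ((y + k')^(d+1) - (y - k)^(d+1)) / (k + k'). Its
    coefficients have the sign of k'^j - (-k)^j, which for even j is where k <= k' enters. *)
Lemma nonneg_poly_geometric (I : Type) (D : I -> Prop) y k k' d :
    nonneg_poly D y -> (0 < k)%N -> (k <= k')%N ->
  nonneg_poly D (fun v => (geometric (y v + k'%:R) * geometric (y v - k%:R)) d).
Proof.
move=> Dy k0 kk'; have s0 : (k + k')%:R != 0 :> F by rewrite pnatr_eq0; lia.
pose a j : F := (k'%:R ^+ j - (- k%:R) ^+ j) *+ 'C(d.+1, j) / (k + k')%:R.
have a0 j : 0 <= a j.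
  rewrite divr_ge0 ?ler0n // mulrn_wge0 // subr_ge0.
  rewrite exprNn.
  have le : k%:R ^+ j <= k'%:R ^+ j :> F by rewrite lerXn2r ?nnegrE ?ler0n ?ler_nat.
  rewrite -signr_odd; case: odd; rewrite ?expr0 ?mul1r // expr1 mulN1r.
  by apply: le_trans (_ : 0 <= _); rewrite ?oppr_le0 exprn_ge0 ?ler0n.
have Da : nonneg_poly D (fun v => \sum_(j < d.+2) a j * y v ^+ (d.+1 - j)).
  apply: nonneg_poly_sum => j _; apply: nonneg_mul; first exact: nonneg_const.
  exact: nonneg_poly_exp.
apply: (eq_nonneg_poly Da) => v; apply: (mulfI s0).
rewrite coef_seriesM /geometric.
have -> : \sum_(i < d.+1) (y v + k'%:R) ^+ i * (y v - k%:R) ^+ (d - i)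
    = \sum_(i < d.+1) (y v + k'%:R) ^+ (d.+1.-1 - i) * (y v - k%:R) ^+ i.
  rewrite (reindex_inj rev_ord_inj); apply: eq_bigr => i _ /=.
  by rewrite subSS subKn // -ltnS.
have -> : (k + k')%:R = (y v + k'%:R) - (y v - k%:R) by rewrite natrD; ring.
rewrite -subrXX !exprDn -sumrB mulr_sumr; apply: eq_bigr => j _.
have <- : (k + k')%:R = (y v + k'%:R) - (y v - k%:R) by rewrite natrD; ring.
by rewrite /a mulrA [_ / _]mulrC mulVKf // -mulrnBl -mulrBr mulrC mulrnAr.
Qed.

End NonnegPoly.

Section Positivity.

Variable F : numFieldType.

(** Lets an induction hypothesis about injective nodes suffice: a step that makes two nodes collide
    has weight 0. *)
Lemma hook_weight_eq0 m (x : 'I_m -> F) k i :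
  ~ injective (shift_at x i k) -> injective x -> hook_weight k x i = 0.
Proof.
move=> ninj x_inj.
have [/existsP[j /andP[ji /eqP e]]|/existsPn noex] :=
    boolP [exists j, (j != i) && (x j == x i - k%:R)].
  by rewrite /hook_weight [X in _ * X](bigD1 j) //= e subrr !mul0r mulr0.
case: ninj => a b; rewrite /shift_at.
have [->|nai] := eqVneq a i; have [->|nbi] := eqVneq b i => //.
- by move=> e; have := noex b; rewrite nbi e eqxx.
- by move=> e; have := noex a; rewrite nai e eqxx.
- exact: x_inj.
Qed.

Lemma coef_hook_series_shift m (x : 'I_m -> F) c k k' i e :
  hook_series (shift_at x i k) c k' e = hook_series x c k' e
    + (k' * k)%:R * \sum_(d < e.-1) hook_series x c k' (e - 2 - d)%N
        * (geometric (x i - c + k'%:R) * geometric (x i - c - k%:R)) d.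
Proof.
rewrite hook_series_shift; move: (hook_series x c k') => S.
rewrite mulrDr mulr1 coef_seriesD; congr (_ + _).
rewrite -mulr_natl -(rmorph_nat (@series_of_poly F)) -polyC_natr /=.
have NE := coef_seriesCM ((k' * k)%:R : F).
move: (geometric (_ + _)) (geometric (_ - _)) (series_of_poly _%:P) NE => A B N NE.
have -> : S * (N * (series_of_poly 'X^2 * A * B))
    = N * (series_of_poly 'X^2 * (A * B * S)) by ring.
rewrite NE; congr (_ * _).
case: e => [|[|e]]; try by rewrite big_ord0 coef_series_XnM_lt.
rewrite (coef_series_XnM 2 (A * B * S) e : (_ : series F) e.+2 = _).
rewrite coef_seriesM.
by apply: eq_bigr => d _; rewrite mulrC !subSS subn0.
Qed.

Definition hook_coef m (x : 'I_m -> F) c (p : nat * nat) := hook_series x c p.1 p.2.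

(* Applying the recursion to the smallest k first keeps all the coefficients
   nonnegative, by nonneg_poly_geometric. *)
Lemma frobenius_rec_nonneg ks : sorted leq ks -> (forall k, k \in ks -> (0 < k)%N) ->
  exists2 f, nonneg_poly (fun p => p.1 \in ks) f &
    forall m (x : 'I_m -> F) c, injective x ->
      (-1) ^+ size ks * (\prod_(k <- ks) k)%N%:R * frobenius_rec ks x
        = f (hook_coef x c).
Proof.
elim: ks => [|k ks IHks] /= sks ks0.
  exists (fun=> 1); first exact: (nonneg_const _ ler01).
  by move=> m x c _; rewrite big_nil !mulr1.
have le_ks : {in ks, forall k', (k <= k')%N}.
  by apply/allP; apply: order_path_min sks; apply: leq_trans.
have k0 : (0 < k)%N by apply: ks0; rewrite inE eqxx.
have [||g Dg gE] := IHks; first exact: path_sorted sks.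
  by move=> k' k'ks; apply: ks0; rewrite inE k'ks orbT.
(* [h p] is the coefficient [p] after the step that lowers node i by [k], as given by
   [coef_hook_series_shift]; the variable [None] stands for x_i - c. *)
pose h (p : nat * nat) (v : option (nat * nat) -> F) : F := v (Some p)
  + (p.1 * k)%:R * \sum_(d < p.2.-1) v (Some (p.1, p.2 - 2 - d)%N)
        * (geometric (v None + p.1%:R) * geometric (v None - k%:R)) d.
have Dh p : p.1 \in ks -> nonneg_poly (with_extra (fun p : nat * nat => p.1 \in ks)) (h p).
  move=> pks; apply: nonneg_add; first by apply: (@nonneg_var _ _ _ (Some p)).
  apply: nonneg_mul; first exact: nonneg_const (ler0n _ _).
  apply: nonneg_poly_sum => d _; apply: nonneg_mul; first by apply: nonneg_var.
  apply: (@nonneg_poly_geometric _ _ _ (fun v => v None)) => //; last exact: le_ks.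
  exact: (@nonneg_var _ _ _ None).
have [T [e [G [DG GE]]]] := nonneg_poly_expand (nonneg_poly_subst Dg Dh).
(* Summed over i with factor -k and the weights, the power [e t] of x_i - c becomes the coefficient
   k + 1 + e t of the series for [k]. *)
exists (fun u => \sum_t u (k, k.+1 + e t)%N * G t u).
  apply: nonneg_poly_sum => t _; apply: nonneg_mul.
    by apply: nonneg_var; rewrite inE eqxx.
  by apply: nonneg_poly_weaken (DG t) _ => p; rewrite inE orbC => ->.
move=> m x c x_inj; rewrite big_cons exprS natrM.
pose v i (o : option (nat * nat)) := if o is Some p then hook_coef x c p else x i - c.
have stepE i : hook_weight k x i
      * ((-1) ^+ size ks * (\prod_(k <- ks) k)%N%:R * frobenius_rec ks (shift_at x i k))
    = hook_weight k x i * \sum_t (x i - c) ^+ e t * G t (hook_coef x c).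
  have [s_inj|ninj] := pselect (injective (shift_at x i k)); last first.
    by rewrite hook_weight_eq0 ?mul0r.
  congr (_ * _); rewrite (gE _ _ c) // -[RHS](GE (v i)); congr (g _).
  by apply/funext => p; rewrite /hook_coef coef_hook_series_shift.
transitivity (- k%:R * \sum_i hook_weight k x i * \sum_t (x i - c) ^+ e t * G t (hook_coef x c)).
  rewrite -(eq_bigr _ (fun i _ => stepE i)) [LHS]mulr_sumr [RHS]mulr_sumr.
  by apply: eq_bigr => i _; ring.
rewrite mulr_sumr; under eq_bigr do rewrite mulrA mulr_sumr.
rewrite exchange_big; apply: eq_bigr => t _ /=.
rewrite /hook_coef /= coef_hook_series // mulr_suml; apply: eq_bigr => i _.
by rewrite mulNr mulrA.
Qed.

End Positivity.

(** * From shifted products to polynomials in Boolean cumulants *)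

Section BooleanSeries.

Variable F : numFieldType.

(* H(z + zeta - a) / z in terms of the coefficients b of H(z + zeta). *)
Definition boolean_series (zeta a : F) (b : nat -> F) : series F := fun e =>
  match e with
  | 0 => 1
  | 1 => zeta - a
  | e'.+2 => \sum_(j < e'.+1) (a ^+ (e' - j) *+ 'C(e', j)) * b j.+2
  end.

(** From index 2 on, the coefficients are weighted sums of powers of x_i - c + a, and the binomial
    theorem recentres them at c. *)
Lemma hook_series_boolean m (x : 'I_m -> F) c a : injective x ->
  hook_series x (c - a) 1 = boolean_series (c - m%:R) a (fun e => hook_series x c 1 e).
Proof.
move=> x_inj; apply/funext => -[|[|e]] /=.
- exact: coef0_hook_series.
- by rewrite coef1_hook_series addrAC.
have cE c' j : hook_series x c' 1 j.+2
    = \sum_i - (1%:R * hook_weight 1 x i) * (x i - c') ^+ j.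
  exact: coef_hook_series.
rewrite cE [LHS](_ : _ = \sum_i \sum_(j < e.+1)
   (a ^+ (e - j) *+ 'C(e, j)) * (- (1%:R * hook_weight 1 x i) * (x i - c) ^+ j)).
  rewrite exchange_big; apply: eq_bigr => j _ /=.
  by rewrite cE mulr_sumr.
apply: eq_bigr => i _; rewrite opprB addrA [x i + a]addrC -addrA exprDn mulr_sumr.
by apply: eq_bigr => j _; rewrite -(mulr_natr (_ * _)) -(mulr_natr (a ^+ _)); ring.
Qed.

(** The bound a <= zeta serves the single coefficient zeta - a; the binomial coefficients only need
    a >= 0. *)
Lemma nonneg_boolean_series zeta a e : 0 <= a -> a <= zeta ->
  nonneg_poly (fun i => 2 <= i)%N (fun b => boolean_series zeta a b e).
Proof.
move=> a0 az; case: e => [|[|e]] /=.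
- exact: nonneg_const ler01.
- by apply: nonneg_const; rewrite subr_ge0.
apply: nonneg_poly_sum => j _; apply: nonneg_mul; last exact: nonneg_var.
by apply: nonneg_const; rewrite mulrn_wge0 ?exprn_ge0.
Qed.

Lemma nonneg_boolean_prod zeta k e : k%:R <= zeta ->
  nonneg_poly (fun i => 2 <= i)%N
    (fun b => (\prod_(a < k) boolean_series zeta a%:R b) e).
Proof.
elim: k e => [|k IHk] e lek.
  apply: (eq_nonneg_poly (f := fun=> (1 : series F) e)) => [|b]; last by rewrite big_ord0.
  by apply: nonneg_const; rewrite coef_series1 ler0n.
have lek' : k%:R <= zeta by apply: le_trans lek; rewrite ler_nat.
pose f b := \sum_(i < e.+1) (\prod_(a < k) boolean_series zeta a%:R b) i
   * boolean_series zeta k%:R b (e - i)%N.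
apply: (eq_nonneg_poly (f := f)) => [|b]; last by rewrite [in RHS]big_ord_recr.
apply: nonneg_poly_sum => i _; apply: nonneg_mul; first exact: IHk.
by apply: nonneg_boolean_series; rewrite ?ler0n.
Qed.

(** Asking for every large enough number of variables lets the two parts of a sum or product live in
    the same polynomial ring. *)
Lemma nonneg_poly_mpoly f : nonneg_poly (fun i => 2 <= i)%N f ->
  exists N0, forall N, (N0 <= N)%N -> exists P : {mpoly F[N]},
    (forall l : 'X_{1..N}, 0 <= P@_l) /\
    (forall b, P.@[fun i : 'I_N => b (i + 2)%N] = f b).
Proof.
elim=> [a a0|i i2|f1 f2 _ [N1 IH1] _ [N2 IH2]|f1 f2 _ [N1 IH1] _ [N2 IH2]].
- exists 0%N => N _; exists a%:MP; split=> [l|b]; last by rewrite mevalC.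
  by rewrite mcoeffC mulr_ge0 ?ler0n.
- exists i => N iN; have lt : (i - 2 < N)%N by lia.
  exists 'X_(Ordinal lt); split=> [l|b]; last by rewrite mevalXU /= subnK.
  by rewrite mcoeffX ler0n.
- exists (maxn N1 N2) => N; rewrite geq_max => /andP[/IH1[P [P0 PE]] /IH2[Q [Q0 QE]]].
  by exists (P + Q); split=> [l|b]; rewrite ?mcoeffD ?addr_ge0 // mevalD PE QE.
exists (maxn N1 N2) => N; rewrite geq_max => /andP[/IH1[P [P0 PE]] /IH2[Q [Q0 QE]]].
exists (P * Q); split=> [l|b]; last by rewrite mevalM PE QE.
by rewrite mcoeffM sumr_ge0 // => k _; rewrite mulr_ge0 ?P0 ?Q0.
Qed.

End BooleanSeries.

(** * Shifted Boolean cumulants *)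

Section Laurent.

Variable F : fieldType.
Implicit Types (p q r : {poly F}).

Lemma laurent_coef_cancel p q r e : r != 0 ->
  laurent_coef (p * r) (q * r) e = laurent_coef p q e.
Proof.
move=> r0; rewrite /laurent_coef mulrA; have [->|q0] := eqVneq q 0.
  by rewrite mul0r !divp0.
by rewrite divp_pmul2r.
Qed.

Lemma laurent_coefD p p' q e :
  laurent_coef (p + p') q e = laurent_coef p q e + laurent_coef p' q e.
Proof. by rewrite /laurent_coef mulrDr divpD coefD. Qed.

Lemma laurent_coefZ a p q e : laurent_coef (a *: p) q e = a * laurent_coef p q e.
Proof. by rewrite /laurent_coef -scalerAr divpZl coefZ. Qed.

Lemma laurent_coef_sum (I : Type) (s : seq I) (P : pred I) (p : I -> {poly F}) q e :
  laurent_coef (\sum_(i <- s | P i) p i) q e = \sum_(i <- s | P i) laurent_coef (p i) q e.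
Proof.
elim/big_rec2: _ => [|i a r _ <-]; first by rewrite /laurent_coef mulr0 div0p coef0.
exact: laurent_coefD.
Qed.

Lemma laurent_coef_pole (y : F) e : laurent_coef 1 ('X - y%:P) e.+1 = y ^+ e.
Proof.
rewrite /laurent_coef mulr1.
have -> : 'X^(e.+1) = (\sum_(i < e.+1) 'X^(e.+1.-1 - i) * y%:P ^+ i) * ('X - y%:P)
    + (y ^+ e.+1)%:P.
  by rewrite mulrC -subrXX polyC_exp subrK.
rewrite divpD mulpK ?polyXsubC_eq0 // [X in _ + X]divp_small ?addr0; last first.
  by rewrite size_XsubC (leq_ltn_trans (size_polyC_leq1 _)).
rewrite coef_sum big_ord_recr big1 /= => [|i _].
  by rewrite subnn expr0 mul1r add0r -polyC_exp coefC.
by rewrite -polyC_exp coefMC coefXn eq_sym subn_eq0 leqNgt ltn_ord mul0r.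
Qed.

End Laurent.

Section Cumulants.

Variables (F : realType) (lam : seq nat).
Hypothesis lamP : is_partition lam.

Notation m := (size lam).

Let row i := nth 0%N lam i.
Let node i : F := (row i)%:R - i%:R.

Lemma addableP i : (i <= m)%N ->
  is_partition (incr_nth lam i) = (i == 0%N) || (row i < row i.-1)%N.
Proof.
move=> lei; apply/idP/idP => [P'|ok].
  case: i lei P' => // i lei P'.
  by have := partition_nth P' (leqnSn i); rewrite !nth_incr_nth eqxx gtn_eqF.
apply/andP; split.
  apply/(sortedP 0%N) => j ltj; rewrite /= !nth_incr_nth.
  have := partition_nth lamP (leqnSn j); rewrite -/(row _) -/(row _).
  case: (i =P j.+1) ok => [-> /=|_ _ le]; first by rewrite gtn_eqF.
  by rewrite add0n (leq_trans le) // leq_addl.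
apply/(nthP 0%N) => -[j ltj]; rewrite nth_incr_nth => /eqP; rewrite addn_eq0.
case/andP; rewrite eqb0 => ij; rewrite -leqn0 leqNgt partition_nth_gt0 //.
move: ltj; rewrite size_incr_nth; case: (ltnP i m) => // lemi.
have im : i = m by apply/eqP; rewrite eqn_leq lei.
by rewrite ltnS leq_eqVlt eq_sym (negPf ij) im.
Qed.

Lemma removableP i : (i < m)%N ->
  sorted geq (set_nth 0%N lam i (row i).-1) = (row i.+1 < row i)%N.
Proof.
move=> lti; have ri : (0 < row i)%N by apply: partition_nth_gt0.
have sz : size (set_nth 0%N lam i (row i).-1) = m.
  by rewrite size_set_nth; apply/maxn_idPr.
apply/idP/idP => [/(sortedP 0%N) P'|ok]; last apply/(sortedP 0%N) => j; rewrite ?sz.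
  have [lti'|le] := ltnP i.+1 m; last by rewrite /row nth_default.
  have := P' i; rewrite sz => /(_ lti'); rewrite /= !nth_set_nth /= eqxx.
  by rewrite gtn_eqF // -ltnS prednK.
move=> ltj; rewrite /= !nth_set_nth /=; have le := partition_nth lamP (leqnSn j).
have [e|ne] := eqVneq j.+1 i.
  by rewrite ltn_eqF -?e // (leq_trans (leq_pred _)) //.
have [e|//] := eqVneq j i.
by rewrite -ltnS prednK // e.
Qed.

Lemma cauchy_den_num :
  cauchy_den F lam * \prod_(i < m) ('X - (node i - 1)%:P)
    = cauchy_num F lam * \prod_(i < m.+1) ('X - (node i)%:P).
Proof.
have iotaE k : iota 0 k = index_iota 0 k by rewrite /index_iota subn0.
have contE i j : (content (i, j))%:~R = j%:R - i%:R :> F.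
  by rewrite /content rmorphB /= -!pmulrn.
have -> : cauchy_den F lam
    = \prod_(i < m.+1 | (i == 0 :> nat) || (row i < row i.-1)%N) ('X - (node i)%:P).
  rewrite /cauchy_den /addable_boxes big_map big_filter.
  rewrite iotaE big_mkord.
  apply: eq_big => [i|i _]; first by rewrite addableP // -ltnS.
  by rewrite contE.
have -> : cauchy_num F lam
    = \prod_(i < m | (row i.+1 < row i)%N) ('X - (node i - 1)%:P).
  rewrite /cauchy_num /removable_boxes big_map big_filter.
  rewrite iotaE big_mkord; apply: eq_big => [i|i _]; first by rewrite removableP.
  have ri : (0 < row i)%N by apply: partition_nth_gt0.
  have e : (row i)%:R = (row i).-1%:R + 1 :> F by rewrite -{1}(prednK ri) -addn1 natrD.
  by rewrite contE /node e; congr ('X - _%:P); ring.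
rewrite [X in _ * X = _](bigID (fun i : 'I_m => row i.+1 < row i)%N) /=.
rewrite [X in _ = _ * X](bigID (fun i : 'I_m.+1 => (i == 0 :> nat) || (row i < row i.-1)%N)) /=.
rewrite [LHS]mulrCA; congr (_ * (_ * _)).
rewrite big_mkcond [RHS]big_mkcond big_ord_recl /= mul1r; apply: eq_bigr => i _.
rewrite -leqNgt; case: ifP => // le.
have e : row i = row i.+1 by apply/eqP; rewrite eqn_leq le partition_nth.
by rewrite /node /bump /= add1n -e -addn1 natrD; congr ('X - _%:P); ring.
Qed.

(** The exponents of lambda + delta exceed the values [node i - 1] by m, hence the centre zeta + m.
    The series has a factor z removed, so the coefficient of z^(-1-e) has index e + 2. *)
Lemma cumulant_hook_coef (zeta : F) e :
  shifted_boolean_cumulant lam zeta e.+2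
    = hook_series (fun i => (shifted_rows lam i)%:R : F) (zeta + m%:R) 1 e.+2.
Proof.
pose x i : F := (shifted_rows lam i)%:R; pose c := zeta + m%:R.
have x_inj : injective x.
  by move=> i j /eqP; rewrite eqr_nat => /eqP/(shifted_rows_inj lamP).
pose y i := x i - c; have y_inj : injective y by apply: shift_inj.
pose Q := \prod_j ('X - (y j)%:P).
have Q0 : Q != 0 by apply/monic_neq0/monic_prod_XsubC.
have compE a : ('X - a%:P) \Po ('X + zeta%:P) = 'X - (a - zeta)%:P :> {poly F}.
  by rewrite comp_polyB comp_polyX comp_polyC polyCB opprB addrA addrAC addrC addrA.
have yE i : y (rev_ord i) = node i - 1 - zeta.
  rewrite /y /x /c /node /row mnmE rev_ordK natrD /= natrB // -(addn1 i) natrD.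
  ring.
have QE : (\prod_(i < m) ('X - (node i - 1)%:P)) \Po ('X + zeta%:P) = Q.
  rewrite rmorph_prod /Q [RHS](reindex_inj rev_ord_inj) /=; apply: eq_bigr => i _.
  by rewrite compE yE.
have hookE : (\prod_(i < m.+1) ('X - (node i)%:P)) \Po ('X + zeta%:P) = hook_num x c 1.
  rewrite rmorph_prod big_ord_recr /= compE /hook_num big_ord1 mulrC; congr (_ * _).
    by congr (_ - _%:P); rewrite /node /row nth_default // /c /=; ring.
  rewrite [RHS](reindex_inj rev_ord_inj) /=; apply: eq_bigr => i _.
  by rewrite compE -/(y _) yE; congr ('X - _%:P); ring.
have num0 : cauchy_num F lam \Po ('X + zeta%:P) != 0.
  rewrite /cauchy_num rmorph_prod; apply/monic_neq0/monic_prod => b _.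
  by rewrite /= compE monicXsubC.
have := congr1 (fun p => p \Po ('X + zeta%:P)) cauchy_den_num.
rewrite !comp_polyM QE hookE => den_num.
rewrite /shifted_boolean_cumulant -(laurent_coef_cancel _ _ _ Q0) den_num.
rewrite mulrC [_ * Q]mulrC laurent_coef_cancel //.
have [A _ ->] := @partial_fraction _ m y y_inj (hook_num x c 1) 1
  (eq_leq (size_hook_num x c 1)).
rewrite laurent_coefD laurent_coef_sum.
(* The polynomial part contributes nothing to negative powers of z; the rest is a sum of simple
   poles. *)
rewrite (_ : laurent_coef (A * _) _ _ = 0) ?add0r; last first.
  by rewrite /laurent_coef mulrA mulpK // exprS -mulrA coefXM.
rewrite (coef_hook_series c 1 e x_inj : _ e.+2 = _); apply: eq_bigr => i _.
rewrite laurent_coefZ hook_residue; congr (_ * _).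
have n0 : nodes_except y i != 0 by apply/monic_neq0/monic_prod_XsubC.
rewrite -[nodes_except y i]mul1r /Q (bigD1 i) //=.
by rewrite laurent_coef_cancel // laurent_coef_pole.
Qed.

End Cumulants.

(** The character is taken over the complex numbers and the cumulants are real; the recursion has
    rational operations only and transfers between them. *)
Lemma frobenius_rec_rmorph (F F' : numFieldType) (phi : {rmorphism F -> F'}) m ks
    (x : 'I_m -> F) :
  frobenius_rec ks (fun i => phi (x i)) = phi (frobenius_rec ks x).
Proof.
elim: ks x => [|k ks IHks] x; first by rewrite rmorph1.
rewrite /= rmorph_sum; apply: eq_bigr => i _; rewrite rmorphM /= -IHks; congr (_ * _).
  rewrite /hook_weight rmorphM !rmorph_prod; congr (_ * _); apply: eq_bigr => j _.
    by rewrite rmorphB rmorph_nat.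
  by rewrite fmorph_div !rmorphB rmorph_nat.
apply: eq_frobenius_rec => j; rewrite /shift_at.
by case: ifP; rewrite // rmorphB rmorph_nat.
Qed.

Lemma eq_boolean_series (F : numFieldType) (zeta a : F) b b' :
  (forall e, b e.+2 = b' e.+2) -> boolean_series zeta a b = boolean_series zeta a b'.
Proof.
by move=> bb'; apply/funext => -[|[|e]] //=; apply: eq_bigr => j _; rewrite bb'.
Qed.

Theorem theorem7 (R : realType) (zeta : R) (ks : seq nat)
    (zeta_ge0 : 0 <= zeta)
    (ks_gt0 : forall k : nat, k \in ks -> (0 < k)%N)
    (ks_le_zeta : forall k : nat, k \in ks -> k%:R <= zeta) :
  exists (N : nat) (P : {mpoly R[N]}),
    (forall m : 'X_{1..N}, 0 <= P@_m) /\
    (forall lam : seq nat, is_partition lam ->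
     forall g : 'S_(sumn lam),
       ((sumn ks <= sumn lam)%N -> has_cycle_type ks g) ->
       (-1) ^+ size ks * normalized_character (complex R) ks g
       = real_complex R
           (P.@[fun i : 'I_N => shifted_boolean_cumulant lam zeta (i + 2)])).
Proof.
(* Sorting puts the smallest cycle first, as the positivity of each step requires; the character
   depends only on the multiset of lengths. *)
pose ks' := sort leq ks.
have ks'_ks : perm_eq ks' ks by rewrite perm_sort.
have [|k|f Df fE] := @frobenius_rec_nonneg R ks'.
- exact: sort_sorted leq_total ks.
- by rewrite mem_sort; apply: ks_gt0.
pose h (p : nat * nat) b := (\prod_(a < p.1) boolean_series zeta a%:R b) p.2.
have Dh p : p.1 \in ks' -> nonneg_poly (fun i => 2 <= i)%N (h p).
  by rewrite mem_sort => /ks_le_zeta; apply: nonneg_boolean_prod.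
(* The product of the cycle lengths, collected from the factors -k of the residues; its inverse is a
   nonnegative constant of the polynomial. *)
pose w : R := (\prod_(k <- ks') k)%N%:R.
have w_gt0 : 0 < w.
  rewrite ltr0n big_seq prodn_cond_gt0 // => k; rewrite mem_sort; exact: ks_gt0.
have w0 : 0 <= w^-1 by rewrite invr_ge0 ltW.
have [N0 /(_ N0 (leqnn _))[P [P0 PE]]] :=
  nonneg_poly_mpoly (nonneg_mul (nonneg_const _ w0) (nonneg_poly_subst Df Dh)).
exists N0, P; split=> // lam lamP g gks.
have -> : normalized_character (complex R) ks g = normalized_character (complex R) ks' g.
  by rewrite /normalized_character (perm_sumn ks'_ks).
rewrite normalized_character_rec //; last first.
  rewrite (perm_sumn ks'_ks) => /gks; rewrite /has_cycle_type (perm_sumn ks'_ks).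
  by move/perm_trans; apply; rewrite perm_cat2r perm_sym.
set m := size lam; pose x i : R := (shifted_rows lam i)%:R; pose c := zeta + m%:R.
have x_inj : injective x.
  by move=> i j /eqP; rewrite eqr_nat => /eqP/(shifted_rows_inj lamP).
rewrite (eq_frobenius_rec ks' (y := fun i => real_complex R (x i))); last first.
  by move=> i; rewrite rmorph_nat.
rewrite frobenius_rec_rmorph -(rmorph_sign (real_complex R)) -rmorphM; congr (_ _).
rewrite (PE (shifted_boolean_cumulant lam zeta)).
apply: (mulfI (lt0r_neq0 w_gt0)); rewrite mulVKf ?lt0r_neq0 //.
(* With c = zeta + m, the linear coefficient c - m - a of the a-th factor is zeta - a, which no
   longer involves the diagram. *)
have -> : (fun p => h p (shifted_boolean_cumulant lam zeta)) = hook_coef x c.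
  apply/funext => p; rewrite /h /hook_coef hook_series_prod; congr (_ p.2).
  apply: eq_bigr => a _; rewrite hook_series_boolean // /c addrK.
  by apply: eq_boolean_series => e; rewrite cumulant_hook_coef.
by rewrite -fE // -/w size_sort mulrCA mulrA.
Qed.
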